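(* Let $K$ be a compact subset of $\mathbb{R}^n$, $n \geq 1$. (i) The function $p \mapsto \operatorname{Cap}_p(K)$ is continuous for $p<0$. (ii) The function $p \mapsto \operatorname{Cap}_p(K)$ is left-continuous at every $p \in \mathbb{R}$. (iii) Let $p \geq 0$. If $\operatorname{Cap}_p(K)>0$ and for some $p_*>p$ the $p$-equilibrium measure $\mu_p$ of $K$ satisfies $$\int_K \int_K \frac{1}{|x-y|^{p_*}} \, d\mu_p(x) \, d\mu_p(y) < \infty ,$$ then the function $r \mapsto \operatorname{Cap}_r(K)$ is right-continuous (and hence continuous) at $r=p$.
   Context: Let $K \subset \mathbb{R}^n$ be compact. A probability measure on $K$ means a positive unit Borel measure on $K$. Logarithmic energy: $V_{\log}(K) = \min_\mu \int_K \int_K \log \frac{1}{|x-y|} \, d\mu(x) \, d\mu(y)$, the minimum being over all probability measures $\mu$ on $K$ (value in $(-\infty,+\infty]$, with the kernel equal to $+\infty$ when $x=y$); $V_{\log}(\emptyset) = +\infty$. Riesz $p$-energy, for $p \in \mathbb{R}\setminus\{0\}$: $V_p(K) = \min_\mu \int_K \int_K |x-y|^{-p} \, d\mu(x) \, d\mu(y)$ if $p>0$ (value in $(0,+\infty]$, with the kernel equal to $+\infty$ when $x=y$), and $V_p(K) = \max_\mu \int_K \int_K |x-y|^{-p} \, d\mu(x) \, d\mu(y)$ if $p<0$, the minimum and maximum being over all probability measures $\mu$ on $K$. By convention $V_p(\emptyset) = +\infty$ for $p>0$ and $V_p(\emptyset)=0$ for $p<0$. Riesz $p$-capacity: $\operatorname{Cap}_p(K)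 = V_p(K)^{-1/p}$ for $p \neq 0$, and $\operatorname{Cap}_0(K) = \exp(-V_{\log}(K))$ (logarithmic capacity), with the conventions $(+\infty)^{-1/p} = 0$ for $p>0$ and $\exp(-\infty)=0$. Equilibrium measure: for $p \geq 0$ with $\operatorname{Cap}_p(K)>0$ (equivalently, finite energy), it is a known fact that exactly one probability measure on $K$ attains the minimum in the definition of $V_p(K)$ (of $V_{\log}(K)$ when $p=0$); it is called the $p$-equilibrium measure of $K$ and denoted $\mu_p$. *)

(* Defs.v *)
From HB Require Import structures.
From mathcomp Require Import all_boot all_order all_algebra.
From mathcomp Require Import all_classical all_reals all_analysis.
Import Order.TTheory GRing.Theory Num.Theory.
Import numFieldNormedType.Exports.

Set Implicit Arguments.
Unset Strict Implicit.
Unset Printing Implicit Defensive.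

Local Open Scope classical_set_scope.
Local Open Scope ring_scope.

(* The library's norm on row vectors is the sup norm; it induces the usual
   topology on R^n, but the kernels below need the Euclidean length. *)
Definition enorm (R : realType) (n : nat) (u : 'rV[R]_n) : R :=
  Num.sqrt (\sum_(i < n) u ord0 i ^+ 2).

Definition borel (R : realType) (n : nat) :=
  g_sigma_algebraType (@open 'rV[R]_n).

(* A Borel probability measure on K, viewed as one on R^n carried by K. *)
Definition prob_on (R : realType) (n : nat) (K : set 'rV[R]_n)
    (mu : probability (borel R n) R) : Prop :=
  mu K = 1%E.

Definition log_kernel (R : realType) (n : nat) (x y : 'rV[R]_n) : \bar R :=
  if x == y then +oo%E else (ln (1 / enorm (x - y)))%:E.

(* For p < 0 the diagonal value is 0 `^ (- p) = 0. *)
Definition riesz_kernel (R : realType) (n : nat) (p : R) (x y : 'rV[R]_n) :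
    \bar R :=
  if (0 < p) && (x == y) then +oo%E else (enorm (x - y) `^ (- p))%:E.

Definition energy (R : realType) (n : nat) (K : set 'rV[R]_n)
    (k : 'rV[R]_n -> 'rV[R]_n -> \bar R) (mu : probability (borel R n) R) :
    \bar R :=
  (\int[mu]_(y in K) \int[mu]_(x in K) k x y)%E.

Definition energies (R : realType) (n : nat) (K : set 'rV[R]_n)
    (k : 'rV[R]_n -> 'rV[R]_n -> \bar R) : set (\bar R) :=
  [set energy K k mu | mu in @prob_on R n K].

(* For K compact and nonempty the infima and the supremum below are attained,
   so they are a minimum and a maximum.  For K empty there is no probability
   measure on K and ereal_inf set0 = +oo, whereas ereal_sup set0 = -oo has to be
   overridden by the convention V_p(set0) = 0 for p < 0. *)
Definition log_energy (R : realType) (n : nat) (K : set 'rV[R]_n) : \bar R :=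
  ereal_inf (energies K (@log_kernel R n)).

Definition riesz_energy (R : realType) (n : nat) (K : set 'rV[R]_n) (p : R) :
    \bar R :=
  if 0 < p then ereal_inf (energies K (riesz_kernel p))
  else if `[< K = set0 >] then 0%E
  else ereal_sup (energies K (riesz_kernel p)).

(* The library's +oo `^ r is +oo for every r != 0, so the convention
   (+oo) ^ (- 1 / p) = 0 for p > 0 is spelled out.  For K compact the energies
   are never -oo, and riesz_energy K p is finite when p < 0. *)
Definition capacity (R : realType) (n : nat) (K : set 'rV[R]_n) (p : R) : R :=
  if p == 0 then
    if log_energy K is v%:E then expR (- v) else 0
  else
    if riesz_energy K p is v%:E then v `^ (- p^-1) else 0.

(* Meant for 0 <= p and 0 < capacity K p, where there is exactly one such
   measure. *)
Definition equilibrium_measure (R : realType) (n : nat) (K : set 'rV[R]_n)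
    (p : R) (mu : probability (borel R n) R) : Prop :=
  prob_on K mu /\
  if p == 0 then energy K (@log_kernel R n) mu = log_energy K
  else energy K (riesz_kernel p) mu = riesz_energy K p.

(* Main.v *)
Require Import Defs.
From HB Require Import structures.
From mathcomp Require Import all_boot all_order all_algebra.
From mathcomp Require Import all_classical all_reals all_analysis.
From mathcomp Require Import measurable_realfun ring lra.
Import Order.TTheory GRing.Theory Num.Theory.
Import numFieldNormedType.Exports.

Set Implicit Arguments.
Unset Strict Implicit.
Unset Printing Implicit Defensive.

Local Open Scope classical_set_scope.
Local Open Scope ring_scope.

(** For a compact set K and every real r put
      h_r(t) = (t^-r - 1) / r  if r <> 0,     h_0(t) = - ln t,
    which is the integral of exp (r v) for v between 0 and - ln t.  Hence h_r(t)
    is nondecreasing and continuous in r, also through r = 0, and decreasing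
    in t.  Let W_r be the infimum of the double integral of h_r(|x - y|) over the
    probability measures on K.  For r <> 0 the Riesz kernel is 1 + r h_r, and
    for r = 0 the logarithmic kernel is h_0, so that V_r = 1 + r W_r (for r < 0
    multiplication by r exchanges infimum and supremum) and V_log = W_0.
    Therefore Cap_r, when positive, is the c with h_r(c) = W_r: for every c > 0,
      c < Cap_r  iff  W_r < h_r(c),     Cap_r < c  iff  h_r(c) < W_r.
    Since r |-> h_r(c) is continuous, one-sided continuity of the capacity is
    that of W, for all signs of r at once.

    Left continuity: W is nondecreasing, so it suffices that W_r with r < p gets
    above every number below W_p.  Otherwise there are r_k increasing to p and
    measures mu_k on K whose h_(r_k)-energies stay below some d < W_p.  For j <= k
    the h_(r_j)-energy of mu_k is also below d.  The kernels h_(r_j) are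
    lower semicontinuous, so a limit measure mu has all its h_(r_j)-energies at
    most d ([energy_compactness]), and Fatou's lemma gives the same bound for its
    h_p-energy, a contradiction ([pot_energy_left]).

    Right continuity: if mu has h_p-energy close to W_p and finite h_q-energy
    for some q > p, dominated convergence gives W_r <= W_p + eps for r slightly
    above p ([pot_energy_right]).  For p >= 0 the equilibrium measure is such a
    measure by assumption; for p < 0 every measure on K has finite h_q-energy as
    soon as q < 0, because h_q is then bounded on K.

    The limit measure is built as the law of a random point.  Half-spaces with
    rational boundaries cut K into cells, coded at depth j by words of j bits.
    The masses of all cells converge along an ultrafilter; the limit masses cut
    [0, 1[ into nested intervals, so each t in [0, 1[ selects an infinite branch of
    nested nonempty cells.  By compactness such a branch shrinks to a point
    X(t) of K ([branch_shrink]), and mu is the image of the uniform law under X.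
    Infima of the kernel over pairs of cells bound the energies of the mu_k from
    below by finite sums, which converge, and Fatou's lemma concludes.

    To have nonnegative integrands, a constant C is added to h_r: if D bounds
    the diameter of K and C = - h_(r0)(D), then h_r + C >= 0 on K for r >= r0. *)

(** * Nested cells of a compact set *)

(** The countable family of half-spaces that bound one coordinate by a rational;
    any two points of R^n are separated by one of them. *)
Definition half_space {R : realType} {n} (i : nat) : set 'rV[R]_n :=
  if (unpickle i : option ('I_n * rat)) is Some (c, q)
  then [set x | x ord0 c < ratr q] else set0.

(** Words are read from right to left: the bit added last is the head of the
    word, and the length of its tail is the index of the half-space it refers to. *)
Fixpoint cell (R : realType) n (K : set 'rV[R]_n) (w : seq bool)
    : set 'rV[R]_n :=
  if w is b :: w' then
    cell K w' `&` (if b then half_space (size w') else ~` half_space (size w'))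
  else K.

Lemma cell_split (R : realType) n (K : set 'rV[R]_n) w :
  cell K w = cell K (true :: w) `|` cell K (false :: w).
Proof. by rewrite /= -setIUr setUv setIT. Qed.

Lemma cell_disj (R : realType) n (K : set 'rV[R]_n) w :
  cell K (true :: w) `&` cell K (false :: w) = set0.
Proof. by rewrite /= setIACA setICr setI0. Qed.

Lemma cell_inj (R : realType) n (K : set 'rV[R]_n) w v x :
  cell K w x -> cell K v x -> size w = size v -> w = v.
Proof.
elim: w v => [|b w IH] [|c v] //= [wx bx] [vx cx] [wv].
rewrite (IH v)//; congr (_ :: _); rewrite wv in bx.
by case: b bx; case: c cx.
Qed.

Lemma cell_sub (R : realType) n (K : set 'rV[R]_n) w : cell K w `<=` K.
Proof. by elim: w => //= b w IH x [/IH]. Qed.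

Lemma open_coord_lt (R : realType) n (c : 'I_n) (a : R) :
  open [set x : 'rV[R]_n | x ord0 c < a].
Proof.
apply: (@open_comp _ _ (fun x : 'rV[R]_n => x ord0 c) [set y | y < a]).
  by move=> x _; exact: coord_continuous.
exact: open_lt.
Qed.

Lemma open_coord_gt (R : realType) n (c : 'I_n) (a : R) :
  open [set x : 'rV[R]_n | a < x ord0 c].
Proof.
apply: (@open_comp _ _ (fun x : 'rV[R]_n => x ord0 c) [set y | a < y]).
  by move=> x _; exact: coord_continuous.
exact: open_gt.
Qed.

Lemma measurable_half_space (R : realType) n i :
  measurable (half_space i : set (borel R n)).
Proof.
rewrite /half_space; case: unpickle => [[c q]|]; last exact: measurable0.
apply: sub_sigma_algebra; rewrite /=.
exact: open_coord_lt.
Qed.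

Lemma measurable_cell (R : realType) n (K : set 'rV[R]_n) w :
  measurable (K : set (borel R n)) -> measurable (cell K w : set (borel R n)).
Proof.
move=> mK; elim: w => //= b w IH; apply: measurableI => //.
by case: b; [|apply: measurableC]; exact: measurable_half_space.
Qed.

Lemma measurable_of_compact (R : realType) n (K : set 'rV[R]_n) :
  compact K -> measurable (K : set (borel R n)).
Proof.
move=> /(compact_closed (@norm_hausdorff _ _)) cK.
rewrite -(setCK K); apply: measurableC; apply: sub_sigma_algebra.
exact: closed_openC.
Qed.

(** A branch of the binary tree of words, along which the cells decrease. *)
Section Branch.
Variables (R : realType) (n : nat) (K : set 'rV[R]_n) (W : nat -> seq bool).
Hypothesis W0 : W 0%N = [::].
Hypothesis WS : forall j, exists b, W j.+1 = b :: W j.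

Lemma size_branch j : size (W j) = j.
Proof. by elim: j => [|j IH]; [rewrite W0|have [b ->] := WS j; rewrite /= IH]. Qed.

Lemma cell_branch_decr i j : (i <= j)%N -> cell K (W j) `<=` cell K (W i).
Proof.
elim: j => [|j IH]; first by rewrite leqn0 => /eqP ->.
rewrite leq_eqVlt => /orP[/eqP -> //|]; rewrite ltnS => /IH h.
by have [b ->] := WS j; move=> x [/h].
Qed.

(** Two distinct points are separated by a half-space of some index k, and all
    the cells of depth greater than k lie on one side of it. *)
Lemma branch_cluster_unique (x y : 'rV[R]_n) :
  cluster (filter_from setT (fun j => cell K (W j))) x ->
  cluster (filter_from setT (fun j => cell K (W j))) y -> x = y.
Proof.
have key (u v : 'rV[R]_n) c :
  cluster (filter_from setT (fun j => cell K (W j))) u ->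
  cluster (filter_from setT (fun j => cell K (W j))) v ->
  ~~ (u ord0 c < v ord0 c).
  move=> Fu Fv; apply/negP => /rat_in_itvoo[q]; rewrite in_itv/= => /andP[uq qv].
  (* The bit of index k decides on which side of the hyperplane the cells lie. *)
  pose k := pickle (c, q).
  have Fk : filter_from setT (fun j => cell K (W j)) (cell K (W k.+1)) by exists k.+1.
  have Nu : nbhs u [set z : 'rV[R]_n | z ord0 c < ratr q].
    by apply: open_nbhs_nbhs; split => //; exact: open_coord_lt.
  have Nv : nbhs v [set z : 'rV[R]_n | ratr q < z ord0 c].
    by apply: open_nbhs_nbhs; split => //; exact: open_coord_gt.
  have [a [+ au]] := Fu _ _ Fk Nu.
  have [b [+ bv]] := Fv _ _ Fk Nv.
  have [e ->] := WS k; rewrite /= size_branch /half_space /k pickleK.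
  case: e => /= -[_ h1] -[_ h2]; first by have := lt_trans h1 bv; rewrite ltxx.
  by apply: h2.
move=> Fx Fy; apply/rowP => c; apply/eqP; rewrite eq_le !leNgt.
by rewrite !key.
Qed.

(** The cells have a cluster point x in K.  If some neighbourhood N of x contained
    no cell, the traces of the cells outside the interior of N would have a
    cluster point too, which differs from x and is a cluster point of the cells. *)
Lemma branch_shrink : compact K -> (forall j, cell K (W j) !=set0) ->
  exists2 x, K x & forall N, nbhs x N -> exists j, cell K (W j) `<=` N.
Proof.
move=> cK ne; set F := filter_from setT (fun j => cell K (W j)).
have Fsub j k : exists2 l, setT l & cell K (W l) `<=` cell K (W j) `&` cell K (W k).
  exists (maxn j k) => // z zl.
  by split; apply: (cell_branch_decr _ zl); rewrite ?leq_maxl ?leq_maxr.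
have FF : ProperFilter F.
  apply: filter_from_proper => //; apply: filter_from_filter; first by exists 0%N.
  by move=> j k _ _; exact: Fsub.
have FK : F K by exists 0%N => //; rewrite W0.
have [x [Kx Fx]] := cK F FF FK.
exists x => // N Nx; apply: contrapT => noj.
pose G := filter_from setT (fun j => cell K (W j) `\` N°).
have GG : ProperFilter G.
  apply: filter_from_proper; last first.
    move=> j _; apply: contrapT => h; apply: noj; exists j => z zj.
    by apply: interior_subset; apply: contrapT => zN; apply: h; exists z.
  apply: filter_from_filter; first by exists 0%N.
  move=> j k _ _; have [l _ hl] := Fsub j k.
  by exists l => // z [/hl[zj zk] zN].
have GK : G K by exists 0%N => //; rewrite W0 => z [].
have [y [Ky Gy]] := cK G GG GK.
have Fy : cluster F y.
  move=> A B [j _ jA] By.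
  have Gj : G (cell K (W j) `\` N°) by exists j.
  have [z [[/jA Az _] Bz]] := Gy _ _ Gj By.
  by exists z.
have xy := branch_cluster_unique Fx Fy; move: Nx; rewrite xy => Ny.
have G0 : G (~` N°) by exists 0%N => // z [].
by have [z []] := Gy _ _ G0 (nbhs_interior Ny).
Qed.

End Branch.

(** * Coding the unit interval by cell masses *)

Definition unif01 (R : realType) : probability (measurableTypeR R) R :=
  uniform_prob (@ltr01 R).

Lemma uniform_itv (R : realType) (a b : R) : 0 <= a -> a <= b -> b <= 1 ->
  unif01 R `[a, b[%classic = (b - a)%:E.
Proof.
move=> a0 ab b1.
have mI : measurable (`[a, b[%classic : set (measurableTypeR R)) by exact: measurable_itv.
transitivity (\int[unif01 R]_t (\1_(`[a, b[%classic : set R) t)%:E)%E.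
  by rewrite integral_indic// setIT.
rewrite integral_uniform//; last first.
  by apply/measurable_EFinP; exact: measurable_indic.
rewrite subr0 invr1 mul1e integral_indic;[|exact: measurable_itv|exact: mI].
rewrite setIidl; last first.
  move=> x /=; rewrite !in_itv/= => /andP[ax xb]; apply/andP; split; lra.
have := lebesgue_measure_itv `[a, b[; rewrite /= => ->.
rewrite lte_fin -EFinD; case: ltP => // h.
by congr EFin; lra.
Qed.

(** The additive masses m of all words cut [0, 1[ into nested half-open intervals,
    the word w receiving the one of length m w that starts at left_end m w. *)
Section Coding.
Variables (R : realType) (m : seq bool -> R).
Hypothesis m0 : m [::] = 1.
Hypothesis m_ge0 : forall w, 0 <= m w.
Hypothesis mS : forall w, m w = m (true :: w) + m (false :: w).

Fixpoint left_end (w : seq bool) : R :=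
  if w is b :: w' then left_end w' + (if b then m (false :: w') else 0) else 0.

Fixpoint word (t : R) (j : nat) : seq bool :=
  if j is j'.+1 then
    let w := word t j' in (left_end w + m (false :: w) <= t) :: w
  else [::].

Lemma size_word t j : size (word t j) = j.
Proof. by elim: j => //= j ->. Qed.

Lemma left_end_bounds w : (0 <= left_end w) && (left_end w + m w <= 1).
Proof.
elim: w => [|b w /andP[h1 h2]] /=; first by rewrite m0 add0r !lexx.
have := mS w; have := m_ge0 (true :: w); have := m_ge0 (false :: w).
by case: b => /= ? ? ?; apply/andP; split; lra.
Qed.

Lemma wordE t w : 0 <= t < 1 ->
  word t (size w) = w <-> left_end w <= t < left_end w + m w.
Proof.
move=> t01; elim: w => [|b w [IH1 IH2]] /=; first by rewrite m0 add0r t01.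
have h := mS w; have h1 := m_ge0 (true :: w); have h2 := m_ge0 (false :: w).
split.
  move=> [bE wE]; move: bE; rewrite wE; have /andP[l1 l2] := IH1 wE.
  case: b => /=; first by rewrite -/(is_true _) => le; apply/andP; split; lra.
  by move=> /negbT; rewrite -ltNge => le; apply/andP; split; lra.
move=> hb; have wE : word t (size w) = w.
  by apply: IH2; move: hb; case: b => /= /andP[? ?]; apply/andP; split; lra.
rewrite wE; congr (_ :: _); case: b hb => /= /andP[? ?]; first lra.
by apply/negbTE; rewrite -ltNge; lra.
Qed.

Lemma mass_word_gt0 t j : 0 <= t < 1 -> 0 < m (word t j).
Proof.
move=> t01; have [+ _] := wordE (word t j) t01.
by rewrite size_word => /(_ erefl) /andP[]; lra.
Qed.

Definition clamp01 (t : R) : R := if 0 <= t < 1 then t else 0.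

Lemma clamp01_in t : 0 <= clamp01 t < 1.
Proof. by rewrite /clamp01; case: ifP => // _; rewrite lexx ltr01. Qed.

(** Clamping sends the complement of [0, 1[ to 0, which adds that null set to the
    fibre of the word of 0. *)
Lemma word_set (w : seq bool) :
  [set t | word (clamp01 t) (size w) = w] =
  `[left_end w, left_end w + m w[%classic `|`
  (if `[< word 0 (size w) = w >] then ~` (`[0, 1[%classic : set R) else set0).
Proof.
have /andP[l0 l1] := left_end_bounds w.
apply/seteqP; split => t /=; rewrite in_itv/=.
  rewrite /clamp01; case: ifP => [t01 /(wordE _ t01)|t01 h]; first by left.
  by right; case: asboolP => //= _; rewrite in_itv/= t01.
move=> [h|].
  have t01 : 0 <= t < 1 by move: h => /andP[? ?]; apply/andP; split; lra.
  by rewrite /clamp01 t01; apply/wordE.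
by case: asboolP => //= hw; rewrite in_itv/= /clamp01; case: ifP.
Qed.

Lemma measurable_word (w : seq bool) :
  measurable ([set t | word (clamp01 t) (size w) = w] : set (measurableTypeR R)).
Proof.
rewrite word_set; apply: measurableU; first exact: measurable_itv.
by case: asboolP => _ //; apply: measurableC; exact: measurable_itv.
Qed.

Lemma word_law (w : seq bool) :
  unif01 R [set t | word (clamp01 t) (size w) = w] = (m w)%:E.
Proof.
have /andP[l0 l1] := left_end_bounds w.
have m01 : measurable (`[0, 1[%classic : set (measurableTypeR R)) by exact: measurable_itv.
have null : unif01 R (~` (`[0, 1[%classic : set R)) = 0%E.
  rewrite (probability_setC _ m01).
  have -> := uniform_itv (lexx 0) (@ler01 R) (lexx 1).
  by rewrite subr0 subee.
rewrite word_set measureU0.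
- apply: (etrans (uniform_itv l0 _ l1)); first by rewrite lerDl.
  by congr EFin; ring.
- exact: measurable_itv.
- by case: asboolP => _ //; exact: measurableC.
- by case: asboolP => _ //; rewrite measure0.
Qed.

End Coding.

(** * The random limit point *)

Lemma ultra_unit_cvg (R : realType) (U : set_system nat) (u : nat -> R) :
  UltraFilter U -> (forall k, 0 <= u k <= 1) -> exists l : R, u @ U --> l.
Proof.
move=> UU u01.
have /(_ (u @ U)) := @segment_compact R 0 1.
case.
- by apply: (@nearW _ U) => k; rewrite /= in_itv/=.
- move=> l [_ Ul]; exists l => V Vl.
  have [//|UnV] := in_ultra_setVsetC (u @^-1` V) UU.
  by have [x []] := Ul (~` V) V UnV Vl.
Qed.

Section LimitLaw.
Variables (R : realType) (n : nat) (K : set 'rV[R]_n) (m : seq bool -> R).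
Hypothesis hK : compact K.
Hypothesis m0 : m [::] = 1.
Hypothesis m_ge0 : forall w, 0 <= m w.
Hypothesis mS : forall w, m w = m (true :: w) + m (false :: w).
Hypothesis ne : forall w, 0 < m w -> cell K w !=set0.

(** X t is the point to which the branch of cells coded by t shrinks; the cells of
    this branch are nonempty because they have positive mass.  Since a cell
    contained in an open set O may shrink to a boundary point of O, X t is in O
    iff some cell of the branch of t lies in the set of points whose ball of
    some fixed radius is contained in O: this makes X measurable. *)
Lemma limit_law : exists X : measurableTypeR R -> borel R n,
  [/\ measurable_fun setT X, forall t, K (X t) &
      forall t (N : set 'rV[R]_n), nbhs (X t : 'rV[R]_n) N ->
        exists j, cell K (word m (clamp01 t) j) `<=` N].
Proof.
have ex t : exists x : 'rV[R]_n, K x /\ forall N, nbhs x N ->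
    exists j, cell K (word m (clamp01 t) j) `<=` N.
  have [||||x Kx hx] := @branch_shrink R n K (word m (clamp01 t)) => //.
  - by move=> j; eexists; reflexivity.
  - by move=> j; apply: ne; apply: mass_word_gt0 => //; exact: clamp01_in.
  - by exists x.
have [X hX] := choice ex.
exists X; split; [|by move=> t; case: (hX t)|by move=> t; case: (hX t)].
apply: measurability; first reflexivity.
move=> _ [ O oO <-]; rewrite setTI.
(* The radii 1 / (k + 1) exhaust O by the sets O_ k. *)
pose O_ (k : nat) := [set x : 'rV[R]_n | ball x (k.+1%:R^-1) `<=` O].
have -> : X @^-1` O = \bigcup_k \bigcup_j \bigcup_(w in [set w | size w = j /\ cell K w `<=` O_ k])
    [set t | word m (clamp01 t) (size w) = w].
  apply/seteqP; split => t.
    move=> Ot; have [KX XN] := hX t.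
    have : nbhs (X t) O by apply: open_nbhs_nbhs; split.
    move=> /nbhs_ballP[e /= e0 eO].
    have e20 : 0 < (e / 2)^-1 by rewrite invr_gt0 divr_gt0.
    pose k := Num.truncn (e / 2)^-1.
    have kP : k.+1%:R^-1 < e / 2.
      by rewrite invf_plt ?posrE ?divr_gt0//; exact: truncnS_gt.
    have [j jN] := XN _ (nbhsx_ballx (X t) (e / 2) (divr_gt0 e0 (ltr0n _ 2))).
    exists k => //; exists j => //; exists (word m (clamp01 t) j).
      split; first by rewrite size_word.
      move=> x /jN Xx y xy; apply: eO; rewrite [e]splitr.
      by apply: ball_triangle Xx _; apply: le_ball xy; exact: ltW.
    by rewrite /= size_word.
  move=> [k _ [j _ [w [sw wO] tw]]]; have [KX XN] := hX t.
  have k0 : 0 < k.+1%:R^-1 :> R by rewrite invr_gt0.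
  have [i iN] := XN _ (nbhsx_ballx (X t) (k.+1%:R^-1) k0).
  pose W := word m (clamp01 t).
  have WS l : exists b, W l.+1 = b :: W l by eexists; reflexivity.
  have [y yW] : cell K (W (maxn i j)) !=set0.
    by apply: ne; apply: mass_word_gt0 => //; exact: clamp01_in.
  have yi := iN _ (cell_branch_decr WS (leq_maxl i j) yW).
  have yj := cell_branch_decr WS (leq_maxr i j) yW.
  rewrite /W -sw tw in yj.
  by apply: (wO _ yj); exact: ball_sym.
apply: bigcupT_measurable => k; apply: bigcupT_measurable => j.
rewrite bigcup_mkcond; apply: countable_bigcupT_measurable => [|w]; first exact: countableP.
by case: ifP => // _; exact: measurable_word.
Qed.
End LimitLaw.

(** * Energies of finite partitions and of image measures *)

Lemma sum_indic (R : realType) (T : Type) (I : finType) (A : I -> set T)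
    (phi : I -> R) (z : T) (i0 : I) : (forall i, A i z -> i = i0) ->
  \sum_(i : I) phi i * \1_(A i) z = phi i0 * \1_(A i0) z.
Proof.
move=> h; rewrite (bigD1 i0)//= big1 ?addr0// => i ii0.
rewrite indicE memNset ?mulr0// => /h ie; by rewrite ie eqxx in ii0.
Qed.

Definition block_sum (R : realType) (j : nat)
    (phi : seq bool -> seq bool -> R) (p : seq bool -> R) : R :=
  \sum_(w : j.-tuple bool * j.-tuple bool) phi w.1 w.2 * (p w.1 * p w.2).

Lemma integral_blocks d (T : measurableType d) (R : realType) (P : probability T R)
    (j : nat) (A : seq bool -> set T) (phi : seq bool -> seq bool -> R) :
  (forall w, measurable (A w)) -> (forall w v, 0 <= phi w v) ->
  (\int[(P \x P)%E]_z
     (\sum_(w : j.-tuple bool * j.-tuple bool) phi w.1 w.2 * \1_(A w.1 `*` A w.2) z)%:E)%E =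
  (block_sum j phi (fun w => fine (P (A w))))%:E.
Proof.
move=> mA phi0.
under eq_integral do rewrite -sumEFin.
rewrite ge0_integral_sum//; first last.
- by move=> w z _; rewrite lee_fin mulr_ge0.
- move=> w; apply/measurable_EFinP; apply: measurable_funM => //.
  by apply: measurable_indic; exact: measurableX.
rewrite /block_sum -sumEFin; apply: eq_bigr => w _.
under eq_integral do rewrite EFinM.
have mAA : measurable (A w.1 `*` A w.2) by exact: measurableX.
rewrite ge0_integralZl_EFin//; first last.
- by apply/measurable_EFinP; exact: measurable_indic.
rewrite integral_indic// setIT EFinM; congr (_ * _)%E.
apply: (etrans (product_measure1E _ _ (mA _) (mA _))).
by rewrite EFinM !fineK// fin_num_measure.
Qed.

(** The image measure enters only through its values, so that the lemma applies to
    any probability that agrees with it. *)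
Lemma energy_pushforward d (T : measurableType d) d' (S : measurableType d')
   (R : realType) (P : probability T R) (Q : probability S R) (X : T -> S)
   (f : S * S -> \bar R) :
  measurable_fun setT X -> (forall A, measurable A -> Q A = P (X @^-1` A)) ->
  measurable_fun setT f -> (forall z, 0 <= f z)%E ->
  (\int[(Q \x Q)]_z f z = \int[(P \x P)]_z f (X z.1, X z.2))%E.
Proof.
move=> mX QP mf f0.
have QE (g : S -> \bar R) : measurable_fun setT g -> (forall y, 0 <= g y)%E ->
    (\int[Q]_y g y = \int[P]_x g (X x))%E.
  move=> mg g0; rewrite (@eq_measure_integral _ _ _ _ (pushforward P X)).
    by rewrite ge0_integral_pushforward// preimage_setT.
  by move=> A mA _; exact: QP.
have mfX : measurable_fun setT (fun z : T * T => f (X z.1, X z.2)).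
  apply: measurableT_comp => //; apply: measurable_fun_pair.
    by apply: measurableT_comp => //; exact: measurable_fst.
  by apply: measurableT_comp => //; exact: measurable_snd.
rewrite !fubini_tonelli1// /fubini_F QE.
- by apply: eq_integral => s _; rewrite QE//; exact: measurable_fun_pair2.
- exact: (@measurable_fun_fubini_tonelli_F _ _ _ _ R Q f mf f0).
- by move=> y; exact: integral_ge0.
Qed.

(** * Lower limits and infima over cells *)

Lemma ereal_between (R : realType) (x y : \bar R) : (x < y)%E ->
  exists a : R, (x < a%:E)%E /\ (a%:E < y)%E.
Proof.
case: x => [r| |]; case: y => [s| |] //.
- by rewrite lte_fin => rs; exists ((r + s) / 2); rewrite !lte_fin; split; lra.
- by move=> _; exists (r + 1); rewrite lte_fin ltry; split => //; lra.
- by move=> _; exists (s - 1); rewrite lte_fin ltNyr; split => //; lra.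
- by move=> _; exists 0; rewrite ltry ltNyr.
Qed.

Lemma limn_einf_ge (R : realType) (u : (\bar R)^nat) (b : \bar R) :
  (forall a : R, (a%:E < b)%E -> exists i, forall j, (i <= j)%N -> (a%:E <= u j)%E) ->
  (b <= limn_einf u)%E.
Proof.
move=> h; rewrite leNgt; apply/negP => /ereal_between[a [+ ab]].
rewrite ltNge => /negP; apply; have [i hi] := h _ ab.
rewrite limn_einf_lim; apply: lime_ge; first exact: is_cvg_einfs.
exists i => // k /= ik; apply: le_ereal_inf_tmp => _ [l kl <-].
by apply: hi; exact: leq_trans kl.
Qed.

Lemma limn_einf_le (R : realType) (u : (\bar R)^nat) (b : \bar R) :
  (forall j, u j <= b)%E -> (limn_einf u <= b)%E.
Proof.
move=> h; rewrite limn_einf_lim; apply: lime_le; first exact: is_cvg_einfs.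
apply: nearW => j; apply: le_trans (h j); apply: ereal_inf_lbound.
by exists j => /=.
Qed.

Lemma measurable_fun_limn_einf d (T : measurableType d) (R : realType) (D : set T)
    (f : (T -> \bar R)^nat) : (forall j, measurable_fun D (f j)) ->
  measurable_fun D (fun x => limn_einf (f^~ x)).
Proof.
move=> mf; apply: (measurableT_comp (f := -%E)) => //.
apply: (@measurable_fun_limn_esup _ _ _ _ (fun j x => - f j x)%E) => j.
exact: measurableT_comp.
Qed.

(** Lower semicontinuity on K * K, spelled with a rectangular neighbourhood because
    cells control the two variables separately. *)
Definition lsc_on (R : realType) (T : topologicalType) (K : set T) (f : T * T -> \bar R) :=
  forall x y (a : R), K x -> K y -> (a%:E < f (x, y))%E ->
  exists N M, [/\ nbhs x N, nbhs y M &
    forall x' y', N x' -> M y' -> K x' -> K y' -> (a%:E < f (x', y'))%E].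

(** Truncation at the depth j makes the infimum finite, also on pairs of cells
    where the kernel is infinite or where there is no point. *)
Definition cell_inf (R : realType) (n : nat) (K : set 'rV[R]_n)
    (f : 'rV[R]_n * 'rV[R]_n -> \bar R) (j : nat) (w v : seq bool) : R :=
  fine (mine (ereal_inf [set f z | z in cell K w `*` cell K v]) j%:R%:E).

Section CellInf.
Variables (R : realType) (n : nat) (K : set 'rV[R]_n).
Variable f : 'rV[R]_n * 'rV[R]_n -> \bar R.
Hypothesis f0 : forall z, (0 <= f z)%E.
Variable j : nat.

Lemma cell_infE w v : ((cell_inf K f j w v)%:E =
  mine (ereal_inf [set f z | z in cell K w `*` cell K v]) j%:R%:E)%E.
Proof.
rewrite /cell_inf fineK//; apply/fin_numPlt; apply/andP; split.
  rewrite lt_min ltNyr andbT; apply: (@lt_le_trans _ _ 0%E) => //.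
  by apply: le_ereal_inf_tmp => _ [z _ <-].
by rewrite gt_min ltry orbT.
Qed.

Lemma cell_inf_ge0 w v : 0 <= cell_inf K f j w v.
Proof.
rewrite -lee_fin cell_infE le_min lee_fin ler0n andbT.
by apply: le_ereal_inf_tmp => _ [z _ <-].
Qed.

Lemma cell_inf_le w v x y : cell K w x -> cell K v y ->
  ((cell_inf K f j w v)%:E <= f (x, y))%E.
Proof.
move=> wx vy; rewrite cell_infE ge_min; apply/orP; left.
by apply: ereal_inf_lbound; exists (x, y).
Qed.

Lemma cell_inf_ge w v (a : R) : a <= j%:R ->
  (forall x y, cell K w x -> cell K v y -> (a%:E <= f (x, y))%E) ->
  a <= cell_inf K f j w v.
Proof.
move=> aj h; rewrite -lee_fin cell_infE le_min lee_fin aj andbT.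
by apply: le_ereal_inf_tmp => _ [[x y] [/= ? ?] <-]; exact: h.
Qed.

End CellInf.

Section Compactness.
Variables (R : realType) (n : nat) (K : set 'rV[R]_n).
Hypothesis hK : compact K.

Definition mass (mu : probability (borel R n) R) (w : seq bool) : R :=
  fine (mu (cell K w)).

Let mcell w : measurable (cell K w : set (borel R n)).
Proof. by apply: measurable_cell; exact: (measurable_of_compact hK). Qed.

Lemma mass_bounds mu w : 0 <= mass mu w <= 1.
Proof.
rewrite /mass -!lee_fin fineK ?fin_num_measure//.
by rewrite measure_ge0/= probability_le1.
Qed.

Lemma mass_split mu w : mass mu w = mass mu (true :: w) + mass mu (false :: w).
Proof.
rewrite /mass (cell_split K w) measureU//; last exact: cell_disj.
by rewrite fineD// fin_num_measure.
Qed.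

Lemma mass_empty mu w : ~ (cell K w !=set0) -> mass mu w = 0.
Proof. by move/set0P/negP/negPn/eqP; rewrite /mass => ->; rewrite measure0. Qed.

(** The step function with values cell_inf on the pairs of cells is below f, and
    block_sum is its integral. *)
Lemma block_sum_le mu (f : borel R n * borel R n -> \bar R) j :
  measurable_fun setT f -> (forall z, 0 <= f z)%E ->
  ((block_sum j (cell_inf K f j) (mass mu))%:E <= \int[(mu \x mu)%E]_z f z)%E.
Proof.
move=> mf f0; have ci0 := cell_inf_ge0 K f0.
rewrite -(integral_blocks mu j mcell (ci0 j)).
apply: ge0_le_integral => //.
- by move=> z _; rewrite lee_fin; apply: sumr_ge0 => w _; rewrite mulr_ge0.
- apply/measurable_EFinP; apply: measurable_sum => w; apply: measurable_funM => //.
  by apply: measurable_indic; exact: measurableX.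
move=> [x y] _.
have [[w [wx wy]]|no] :=
  pselect (exists w : j.-tuple bool * j.-tuple bool, cell K w.1 x /\ cell K w.2 y).
  rewrite (@sum_indic R _ _ (fun w : j.-tuple bool * j.-tuple bool => cell K w.1 `*` cell K w.2)
    (fun w => cell_inf K f j w.1 w.2) (x, y) w).
    by rewrite indicE mem_set// mulr1; exact: cell_inf_le.
  move=> [w' v'] [/= w'x v'y]; rewrite [w]surjective_pairing; congr (_, _); apply: val_inj.
    by apply: (cell_inj w'x wx); rewrite !size_tuple.
  by apply: (cell_inj v'y wy); rewrite !size_tuple.
rewrite big1// => w _; rewrite indicE memNset ?mulr0//= => -[wx wy].
by apply: no; exists w.
Qed.

End Compactness.

(** * Compactness of measures for lower semicontinuous energies *)

(** The measure mu is a weak limit of the mu_k along an ultrafilter; the statement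
    keeps only the semicontinuity of the energies along it, for all kernels
    with the same mu. *)
Theorem energy_compactness (R : realType) (n : nat) (K : set 'rV[R]_n)
    (mu_ : nat -> probability (borel R n) R) :
  compact K -> (forall k, prob_on K (mu_ k)) ->
  exists mu : probability (borel R n) R, prob_on K mu /\
    forall (f : borel R n * borel R n -> \bar R) (a : R),
      measurable_fun setT f -> (forall z, 0 <= f z)%E -> lsc_on (K : set 'rV[R]_n) f ->
      (exists i, forall k, (i <= k)%N -> \int[(mu_ k \x mu_ k)%E]_z f z <= a%:E)%E ->
      (\int[(mu \x mu)%E]_z f z <= a%:E)%E.
Proof.
move=> hK hmu.
have mK := measurable_of_compact hK.
have [U [UU oU]] := ultraFilterLemma (@eventually_filter).
have /choice[m hm] : forall w, exists l : R, (mass K (mu_ k) w @[k --> U]) --> l.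
  by move=> w; apply: ultra_unit_cvg => k; exact: mass_bounds.
have Uuniq w l : (mass K (mu_ k) w @[k --> U]) --> l -> m w = l.
  by move=> h; apply: (cvg_unique _ (hm w) h).
have m0 : m [::] = 1.
  apply: Uuniq; apply: cvg_near_cst; apply: nearW => k.
  by rewrite /mass /= hmu.
have m_ge0 w : 0 <= m w.
  apply: cvgr_to_ge (hm w) _.
  by apply: nearW => k; have /andP[] := mass_bounds hK (mu_ k) w.
have mS w : m w = m (true :: w) + m (false :: w).
  apply: Uuniq; under eq_cvg do rewrite mass_split//.
  exact: cvgD.
have ne w : 0 < m w -> cell K w !=set0.
  move=> mw; apply: contrapT => h; move: mw; suff -> : m w = 0 by rewrite ltxx.
  by apply: Uuniq; apply: cvg_near_cst; apply: nearW => k; rewrite mass_empty.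
have [X [mX KX Xcell]] := limit_law hK m0 m_ge0 mS ne.
pose P := unif01 R.
pose Xm : {mfun measurableTypeR R >-> borel R n} := mfun_Sub (mem_set mX).
pose mu : probability (borel R n) R := distribution P Xm.
have muE A : measurable A -> mu A = P (X @^-1` A) by [].
exists mu; split.
  rewrite /prob_on muE// (_ : X @^-1` K = setT) ?probability_setT//.
  by apply/seteqP; split => // t _; exact: KX.
move=> f a mf f0 lf [i hi].
rewrite (energy_pushforward mX muE mf f0).
pose W t j := word m (clamp01 t) j.
pose A w := [set t | W t (size w) = w] : set (measurableTypeR R).
have mA w : measurable (A w) by exact: measurable_word.
have ci0 j := cell_inf_ge0 K f0 j.
have block_le j : block_sum j (cell_inf K f j) m <= a.
  have cvb : (block_sum j (cell_inf K f j) (mass K (mu_ k)) @[k --> U]) -->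
      block_sum j (cell_inf K f j) m.
    apply: (@cvg_big R^o) => [|w _]; first exact: add_continuous.
    apply: cvgM; first exact: cvg_cst.
    by apply: cvgM; exact: hm.
  apply: cvgr_to_le cvb _.
  apply: oU; exists i => // k /= /hi h; rewrite -lee_fin.
  by apply: le_trans h; exact: block_sum_le.
(* The step functions of the cells, transported to the square of [0, 1[. *)
pose g j (z : measurableTypeR R * measurableTypeR R) : \bar R :=
  (cell_inf K f j (W z.1 j) (W z.2 j))%:E.
have gE j z : g j z = (\sum_(w : j.-tuple bool * j.-tuple bool)
     cell_inf K f j w.1 w.2 * \1_(A w.1 `*` A w.2) z)%:E.
  case: z => s t; have sz u : size (W u j) == j by rewrite size_word.
  rewrite (@sum_indic R _ _ (fun w : j.-tuple bool * j.-tuple bool => A w.1 `*` A w.2)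
    (fun w => cell_inf K f j w.1 w.2) (s, t) (Tuple (sz s), Tuple (sz t))).
    rewrite /g indicE mem_set ?mulr1//; split => //=; by rewrite /A /= size_word.
  move=> [w v] [/=]; rewrite /A /= !size_tuple => ws vt.
  by congr (_, _); apply: val_inj.
have mg j : measurable_fun setT (g j).
  rewrite (funext (gE j)).
  apply/measurable_EFinP; apply: measurable_sum => w; apply: measurable_funM => //.
  by apply: measurable_indic; apply: measurableX.
have int_g j : (\int[(P \x P)%E]_z g j z <= a%:E)%E.
  under eq_integral do rewrite gE.
  rewrite (integral_blocks P j mA (ci0 j)) lee_fin; apply: le_trans (block_le j).
  rewrite le_eqVlt; apply/orP; left; apply/eqP; congr block_sum.
  by apply/funext => w; rewrite /A /W word_law.
(* The kernel at (X s, X t) is at most the lower limit of its infima over cells. *)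
have fatou_g : (\int[(P \x P)%E]_z limn_einf (g^~ z) <= a%:E)%E.
  apply: (@le_trans _ _ (limn_einf (fun j => \int[(P \x P)%E]_z g j z)%E)).
    by apply: fatou => // j z _; rewrite lee_fin.
  exact: limn_einf_le.
apply: le_trans fatou_g; apply: ge0_le_integral => //.
- apply: measurableT_comp => //; apply: measurable_fun_pair.
    by apply: measurableT_comp => //; exact: measurable_fst.
  by apply: measurableT_comp => //; exact: measurable_snd.
- exact: measurable_fun_limn_einf.
move=> [s t] _ /=; apply: limn_einf_ge => b bf.
have [N [M [sN tM NM]]] := lf _ _ _ (KX s) (KX t) bf.
have [j1 j1N] := Xcell _ _ sN; have [j2 j2M] := Xcell _ _ tM.
exists (maxn (maxn j1 j2) (Num.truncn b).+1) => j; rewrite !geq_max -andbA.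
move=> /and3P[le1 le2 lb]; rewrite lee_fin; apply: cell_inf_ge => //.
  by apply: le_trans (ltW (truncnS_gt b)) _; rewrite ler_nat.
have WS u l : exists c, W u l.+1 = c :: W u l by eexists; reflexivity.
move=> x y xW yW; apply: ltW; apply: NM.
- by apply: j1N; exact: (cell_branch_decr (WS s) le1).
- by apply: j2M; exact: (cell_branch_decr (WS t) le2).
- exact: cell_sub xW.
- exact: cell_sub yW.
Qed.

(** * The slope of the exponential *)

(** The integral of exp (r v) for v from 0 to u. *)
Definition slope (R : realType) (r u : R) : R :=
  if r == 0 then u else (expR (r * u) - 1) / r.

Section Slope.
Variable R : realType.
Implicit Types r s u v p x : R.

(** Convexity of the exponential between 0 and x, obtained from its tangent line at
    the intermediate point th * x. *)
Lemma expR_convex01 x (th : R) : 0 <= th <= 1 ->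
  expR (th * x) <= 1 - th + th * expR x.
Proof.
move=> /andP[t0 t1]; set m := th * x; set E := expR m.
have h1 : E * (1 - m) <= 1.
  rewrite -[leRHS](expR0 R) -(addrN m) expRD ler_pM2l ?expR_gt0//.
  by rewrite (le_trans _ (expR_ge1Dx _)).
have h2 : E * (1 + (x - m)) <= expR x.
  have -> : expR x = E * expR (x - m) by rewrite -expRD; congr expR; ring.
  by rewrite ler_pM2l ?expR_gt0// expR_ge1Dx.
have h3 := ler_wpM2l t0 h2.
have h4 : (1 - th) * (E * (1 - m)) <= (1 - th) * 1 by rewrite ler_wpM2l// subr_ge0.
suff : E = (1 - th) * (E * (1 - m)) + th * (E * (1 + (x - m))) by lra.
by rewrite /m; ring.
Qed.

Lemma slope_ge r u : 0 < r -> u <= slope r u.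
Proof.
move=> r0; rewrite /slope gt_eqF// ler_pdivlMr//.
by have := expR_ge1Dx (r * u); lra.
Qed.

Lemma slope_le r u : r < 0 -> slope r u <= u.
Proof.
move=> r0; rewrite /slope lt_eqF// ler_ndivrMr//.
by have := expR_ge1Dx (r * u); lra.
Qed.

(** For exponents of the same sign this is the monotonicity of the difference
    quotients of the exponential at 0; the value u at r = 0 separates the signs. *)
Lemma le_slope r s u : r <= s -> slope r u <= slope s u.
Proof.
rewrite le_eqVlt => /orP[/eqP -> //|rs].
have [r0|r0|r0] := ltgtP r 0; have [s0|s0|s0] := ltgtP s 0; try by lra.
- rewrite /slope !lt_eqF//.
  have th : 0 <= s / r <= 1.
    by rewrite ler_ndivlMr// ler_ndivrMr// mul0r mul1r !ltW.
  have := expR_convex01 (r * u) th.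
  have -> : s / r * (r * u) = s * u by field; lra.
  move=> h; rewrite ler_ndivlMr//.
  have -> : (expR (r * u) - 1) / r * s = s / r * (expR (r * u) - 1) by ring.
  by lra.
- by apply: (le_trans (slope_le u r0)); apply: slope_ge.
- by rewrite s0; apply: (le_trans (slope_le u r0)); rewrite /slope eqxx.
- rewrite /slope !gt_eqF//.
  have th : 0 <= r / s <= 1.
    by rewrite ler_pdivlMr// ler_pdivrMr// mul0r mul1r !ltW.
  have := expR_convex01 (s * u) th.
  have -> : r / s * (s * u) = r * u by field; lra.
  move=> h; rewrite ler_pdivrMr//.
  have -> : (expR (s * u) - 1) / s * r = r / s * (expR (s * u) - 1) by ring.
  by lra.
- by rewrite r0; apply: (le_trans _ (slope_ge u s0)); rewrite /slope eqxx.
Qed.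

Lemma lt_slope r u v : u < v -> slope r u < slope r v.
Proof.
move=> uv; rewrite /slope; case: (ltgtP r 0) => // r0.
- by rewrite ltr_nM2r ?invr_lt0// ltrD2r ltr_expR ltr_nM2l.
- by rewrite ltr_pM2r ?invr_gt0// ltrD2r ltr_expR ltr_pM2l.
Qed.

Lemma cvg_expR_mulr u p : expR (r * u) @[r --> p] --> expR (p * u).
Proof.
by apply: continuous_cvg; [exact: continuous_expR|exact: mulrr_continuous].
Qed.

(** At r = 0 the slope lies between u and u * exp (r * u), on the side given by the
    sign of r. *)
Lemma slope_continuous_param u : continuous (fun r => slope r u).
Proof.
move=> p; have [->|p0] := eqVneq p 0.
  rewrite /continuous_at {2}/slope eqxx.
  have cv : u * expR (r * u) @[r --> (0:R)] --> u.
    rewrite -[X in _ --> X]mulr1; apply: cvgM; first exact: cvg_cst.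
    by have := @cvg_expR_mulr u 0; rewrite mul0r expR0.
  have cd : `|u * expR (r * u) - u| @[r --> (0:R)] --> (0 : R).
    rewrite -[X in _ --> X](@normr0 R R) -[X in `|X|](subrr u).
    by apply: cvg_norm; apply: cvgB cv _; exact: cvg_cst.
  apply: (@squeeze_cvgr _ _ _ _ (fun r => u - `|u * expR (r * u) - u|)
      (fun r => u + `|u * expR (r * u) - u|)).
  - apply: nearW => r; rewrite -ler_distl.
    have e1 := expR_ge1Dx (r * u); have e2 := expR_ge1Dx (- (r * u)).
    have e3 : expR (r * u) - 1 <= r * u * expR (r * u).
      have := ler_wpM2l (expR_ge0 (r * u)) e2.
      by rewrite -expRD addrN expR0; lra.
    rewrite /slope; case: (ltgtP r 0) => r0; last by rewrite subrr normr0.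
    + rewrite !ler0_norm ?subr_le0.
      * by rewrite lerN2 lerD2r ler_ndivlMr//; lra.
      * by rewrite -(ler_nM2l r0); lra.
      * by rewrite ler_ndivrMr//; lra.
    + rewrite !ger0_norm ?subr_ge0.
      * by rewrite lerD2r ler_pdivrMr//; lra.
      * by rewrite -(ler_pM2l r0); lra.
      * by rewrite ler_pdivlMr//; lra.
  - by rewrite -[X in _ --> X]subr0; apply: cvgB cd; exact: cvg_cst.
  - by rewrite -[X in _ --> X]addr0; apply: cvgD cd; exact: cvg_cst.
have near0 : \forall r \near p, (expR (r * u) - 1) / r = slope r u.
  by near=> r; rewrite /slope ifF//; apply/negbTE; near: r; exact: (cvgr_neq0 _ cvg_id).
apply: (cvg_trans (near_eq_cvg near0)).
rewrite /slope (negbTE p0); apply: cvgM; last by apply: cvgV => //; exact: cvg_id.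
apply: cvgB; last exact: cvg_cst.
apply: continuous_cvg; first exact: continuous_expR.
    exact: mulrr_continuous.
Unshelve. all: by end_near. Qed.

Lemma slope_continuous r : continuous (slope r).
Proof.
move=> u; rewrite /slope; case: eqP => [_|r0]; first exact: cvg_id.
apply: cvgM; last exact: cvg_cst.
apply: cvgB; last exact: cvg_cst.
apply: continuous_cvg; first exact: continuous_expR.
exact: mulrl_continuous.
Qed.
End Slope.

(** * The potential interpolating Riesz and logarithmic kernels *)

(** The function h_r at positive arguments, and at 0 for r < 0. *)
Definition potr (R : realType) (r t : R) : R :=
  if r == 0 then - ln t else (t `^ (- r) - 1) / r.

(** The function h_r on the whole half-line, with its infinite value at 0 for r >= 0. *)
Definition pot (R : realType) (r t : R) : \bar R :=
  if (0 <= r) && (t == 0) then +oo%E else (potr r t)%:E.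

Section Pot.
Variable R : realType.
Implicit Types r s t p a : R.

Lemma potrE r t : 0 < t -> potr r t = slope r (- ln t).
Proof.
move=> t0; rewrite /potr /slope; case: eqP => // _.
by rewrite /powR gt_eqF// mulrN mulNr.
Qed.

Lemma potr0 r : r < 0 -> potr r 0 = - r^-1.
Proof.
move=> r0; rewrite /potr lt_eqF// powR0 ?oppr_eq0 ?lt_eqF//.
by rewrite sub0r mulN1r.
Qed.

Lemma potE r t : 0 < t -> pot r t = (potr r t)%:E.
Proof. by move=> t0; rewrite /pot gt_eqF// andbF. Qed.

Lemma le_pot r s t : 0 <= t -> r <= s -> (pot r t <= pot s t)%E.
Proof.
rewrite le_eqVlt => /orP[/eqP <-|t0] rs; last first.
  by rewrite !potE// lee_fin !potrE// le_slope.
rewrite /pot eqxx !andbT; case: (leP 0 s) => s0; first by rewrite leey.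
rewrite ifF; last by apply/negbTE; rewrite -ltNge (le_lt_trans rs).
have r0 := le_lt_trans rs s0.
by rewrite !potr0// lee_fin lerN2 lef_nV2.
Qed.

Lemma pot_anti r t t' : 0 <= t -> t <= t' -> (pot r t' <= pot r t)%E.
Proof.
move=> t0; rewrite le_eqVlt => /orP[/eqP -> //|tt'].
have t'0 := le_lt_trans t0 tt'.
move: t0; rewrite le_eqVlt => /orP[/eqP <-|t0]; last first.
  rewrite !potE// !potrE// lee_fin ltW// lt_slope// ltrN2 ltr_ln ?posrE//.
rewrite [leRHS]/pot eqxx andbT potE//; case: (leP 0 r) => [_|r0]; first by rewrite leey.
rewrite potr0// lee_fin /potr lt_eqF// ler_ndivrMr// mulNr mulVf ?lt_eqF//.
by have := powR_ge0 t' (- r); lra.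
Qed.

Lemma potr_continuous t : 0 < t -> continuous (fun r => potr r t).
Proof.
move=> t0; rewrite (_ : (fun r => _) = (fun r => slope r (- ln t))).
  exact: slope_continuous_param.
by apply/funext => r; rewrite potrE.
Qed.

(** Together with the monotonicity in t this is lower semicontinuity in t. *)
Lemma pot_lsc r t a : 0 <= t -> (a%:E < pot r t)%E ->
  exists2 t', t < t' & (a%:E < pot r t')%E.
Proof.
rewrite le_eqVlt => /orP[/eqP <-|t0]; last first.
  rewrite potE// lte_fin potrE// => at'.
  have : \forall v \near - ln t, a < slope r v.
    by apply: (cvgr_gt _ (@slope_continuous _ r (- ln t))).
  move=> /nbhs_ballP[e /= e0 he].
  exists (expR (ln t + e / 2)).
    by rewrite -[ltLHS](lnK (x := t)) ?posrE// ltr_expR; lra.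
  rewrite potE ?expR_gt0// potrE ?expR_gt0// expRK lte_fin; apply: he.
  rewrite /ball/= (_ : - ln t - - (ln t + e / 2) = e / 2); last by ring.
  by rewrite gtr0_norm; lra.
rewrite {1}/pot eqxx andbT; case: (leP 0 r) => r0.
  (* For r >= 0 the potential is at least - ln t'. *)
  move=> _; exists (expR (- (a + 1))); first exact: expR_gt0.
  rewrite potE ?expR_gt0// lte_fin potrE ?expR_gt0// expRK opprK.
  apply: (@lt_le_trans _ _ (a + 1)); first lra.
  have := le_slope (a + 1) r0; by rewrite {1}/slope eqxx.
(* t' is chosen so that t' ^ (- r) = (1 + r * a) / 2, which is below 1 + r * a. *)
rewrite potr0// lte_fin => ar.
have b0 : 0 < (1 + r * a) / 2.
  rewrite divr_gt0//.
  move: ar; rewrite -(ltr_nM2l r0) mulrN divff ?lt_eqF//; lra.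
exists (expR (- (ln ((1 + r * a) / 2) / r))); first exact: expR_gt0.
rewrite potE ?expR_gt0// lte_fin potrE ?expR_gt0// expRK opprK.
rewrite /slope lt_eqF// [r * _]mulrC divfK ?lt_eqF// lnK// ltr_ndivlMr//; lra.
Qed.

(** Left lower semicontinuity in the exponent.  At t = 0 the value - 1 / r blows up
    as r tends to 0 from below, in accordance with the infinite value at r = 0. *)
Lemma pot_left p t a : 0 <= t -> (a%:E < pot p t)%E ->
  exists2 r, r < p & (a%:E < pot r t)%E.
Proof.
rewrite le_eqVlt => /orP[/eqP <-|t0]; last first.
  rewrite potE// lte_fin => ap.
  have : \forall v \near p, a < potr v t.
    by apply: (cvgr_gt _ (@potr_continuous t t0 p)).
  move=> /nbhs_ballP[e /= e0 he]; exists (p - e / 2); first lra.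
  rewrite potE// lte_fin; apply: he.
  rewrite /ball/= (_ : p - (p - e / 2) = e / 2); last by ring.
  by rewrite gtr0_norm; lra.
rewrite {1}/pot eqxx andbT; case: (leP 0 p) => p0.
  move=> _; have a0 := normr_ge0 a; have a1 := ler_norm a.
  have n0 : - (`|a| + 1)^-1 < 0 by rewrite oppr_lt0 invr_gt0; lra.
  exists (- (`|a| + 1)^-1); first exact: lt_le_trans p0.
  rewrite /pot leNgt n0/= potr0// invrN invrK opprK lte_fin; lra.
rewrite potr0// lte_fin => ap.
have cv : - v^-1 @[v --> p] --> - p^-1.
  by apply: cvgN; apply: inv_continuous; rewrite lt_eqF.
have : \forall v \near p, a < - v^-1 by apply: (cvgr_gt _ cv).
move=> /nbhs_ballP[e /= e0 he].
have r0 : p - e / 2 < 0 by lra.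
exists (p - e / 2); first lra.
rewrite /pot leNgt r0/= potr0// lte_fin; apply: he.
rewrite /ball/= (_ : p - (p - e / 2) = e / 2); last by ring.
by rewrite gtr0_norm; lra.
Qed.

End Pot.

(** * Energies as integrals over the square *)

Lemma integral_full_set d (T : measurableType d) (R : realType) (P : probability T R)
    (D : set T) (f : T -> \bar R) :
  measurable D -> P D = 1%E -> measurable_fun setT f -> (forall x, 0 <= f x)%E ->
  (\int[P]_(x in D) f x = \int[P]_x f x)%E.
Proof.
move=> mD PD mf f0.
rewrite -[in RHS](setUv D) ge0_integral_setU//.
- rewrite [X in (_ + X)%E]null_set_integral ?adde0//.
  + exact: measurableC.
  + exact: measurable_funTS.
  + by have := probability_setC P mD; rewrite PD subee.
- exact: measurableC.
- exact: measurable_funTS.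
- by apply/disj_setPS => x [].
Qed.

Lemma integral_cst_full d (T : measurableType d) (R : realType) (P : probability T R)
    (D : set T) (c : R) :
  measurable D -> P D = 1%E -> (\int[P]_(x in D) (c%:E) = c%:E)%E.
Proof. by move=> mD PD; rewrite -[RHS]mule1 -PD; exact: integral_cst. Qed.

(** When the integral of f is infinite, al is positive: the negative part of
    al * f + be is bounded by |be|, so that its integral is infinite too. *)
Lemma integral_affine d (T : measurableType d) (R : realType) (P : probability T R)
    (D : set T) (f : T -> \bar R) (al be : R) :
  measurable D -> P D = 1%E -> measurable_fun setT f -> (forall x, 0 <= f x)%E ->
  0 < al \/ (\int[P]_x f x < +oo)%E ->
  (\int[P]_(x in D) (al%:E * f x + be%:E) = al%:E * \int[P]_x f x + be%:E)%E.
Proof.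
move=> mD PD mf f0 hal; rewrite -(integral_full_set mD PD mf f0).
have mfD : measurable_fun D f by exact: measurable_funTS.
have icst_ c : (\int[P]_(x in D) (c%:E) = c%:E)%E.
  exact: integral_cst_full.
have bePD : (\int[P]_(x in D) (be%:E) = be%:E)%E.
  exact: icst_.
have icst : P.-integrable D (cst be%:E).
  apply/integrableP; split; first exact: measurable_cst.
  by rewrite /= icst_ ltry.
have [If|] := ltP (\int[P]_(x in D) f x)%E +oo%E.
  have fi : P.-integrable D f.
    apply/integrableP; split=> //.
    by under eq_integral do rewrite gee0_abs//.
  rewrite integralD//; last exact: integrableZl.
  by rewrite bePD integralZl.
rewrite leye_eq => /eqP Iy; rewrite Iy.
have al0 : 0 < al.
  by case: hal => // ; rewrite -(integral_full_set mD PD mf f0) Iy ltxx.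
rewrite gt0_muley ?lte_fin// addye//.
set h := fun x => _.
have mh : measurable_fun D h.
  apply: emeasurable_funD; last exact: measurable_cst.
  exact: measurable_funeM.
have hneg : (\int[P]_(x in D) h^\- x <= `|be|%:E)%E.
  rewrite -(icst_ `|be|).
  apply: ge0_le_integral => //.
  - exact: measurable_funeneg.
  - move=> x _; rewrite funenegE ge_max lee_fin normr_ge0 andbT /h.
    rewrite fin_num_oppeD//; apply: (@le_trans _ _ (- be%:E)%E).
      by rewrite geeDr// oppe_le0 mule_ge0// lee_fin ltW.
    by rewrite lee_fin -normrN ler_norm.
have hpos : (\int[P]_(x in D) h^\+ x = +oo)%E.
  apply/eqP; rewrite -leye_eq.
  have : (\int[P]_(x in D) (al%:E * f x) <= \int[P]_(x in D) (h^\+ x + `|be|%:E))%E.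
    apply: ge0_le_integral => //.
    - by move=> x _; rewrite mule_ge0// lee_fin ltW.
    - exact: measurable_funeM.
    - by apply: emeasurable_funD; [exact: measurable_funepos|exact: measurable_cst].
    - move=> x _; apply: (@le_trans _ _ (h x + `|be|%:E)%E).
        rewrite /h -addeA leeDl// -EFinD lee_fin.
        by rewrite -lerBlDl sub0r -normrN ler_norm.
      by rewrite leeD2r// funeposE le_max lexx.
  rewrite ge0_integralZl_EFin//; [|exact: ltW].
  rewrite Iy gt0_muley ?lte_fin// ge0_integralD//; last exact: measurable_funepos.
  rewrite icst_.
  rewrite !leye_eq; case: (integral _ _ _) => //.
rewrite integralE hpos addye// -(@fineK _ (\int[P]_(x in D) h^\- x)%E)//.
by rewrite ge0_fin_numE ?integral_ge0// (le_lt_trans hneg)// ltry.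
Qed.

(** The kernel is prescribed on K * K only, whereas g is nonnegative everywhere, so
    that Tonelli's theorem applies without restriction to K. *)
Lemma energy_affine (R : realType) (n : nat) (K : set 'rV[R]_n)
    (mu : probability (borel R n) R) (k : 'rV[R]_n -> 'rV[R]_n -> \bar R)
    (g : borel R n * borel R n -> \bar R) (al be : R) :
  compact K -> prob_on K mu -> measurable_fun setT g -> (forall z, 0 <= g z)%E ->
  0 < al \/ (exists M : R, forall z, (g z <= M%:E)%E) ->
  (forall x y, K x -> K y -> k x y = (al%:E * g (x, y) + be%:E)%E) ->
  energy K k mu = (al%:E * \int[(mu \x mu)%E]_z g z + be%:E)%E.
Proof.
move=> hK muK mg g0 hal kE.
have mK := measurable_of_compact hK.
have mG : measurable_fun setT (fubini_G mu g).
  exact: (@measurable_fun_fubini_tonelli_G _ _ _ _ R mu g mg g0).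
have G0 y : (0 <= fubini_G mu g y)%E by exact: integral_ge0.
have int_le (h : borel R n -> \bar R) (M : R) : measurable_fun setT h ->
    (forall x, 0 <= h x)%E -> (forall x, h x <= M%:E)%E -> (\int[mu]_x h x <= M%:E)%E.
  move=> mh h0 hM; apply: (@le_trans _ _ (\int[mu]_x (cst M%:E) x)%E).
    by apply: ge0_le_integral.
  by rewrite integral_cst_full// probability_setT.
have -> : energy K k mu = (\int[mu]_(y in K) (al%:E * fubini_G mu g y + be%:E))%E.
  apply: eq_integral => y; rewrite inE => Ky.
  rewrite /fubini_G -(integral_affine be mK muK).
  - by apply: eq_integral => x; rewrite inE => Kx; rewrite kE.
  - exact: measurable_fun_pair1.
  - by move=> x; exact: g0.
  - case: hal => [|[M gM]]; [by left|right].
    by apply: le_lt_trans (int_le _ M _ _ _) (ltry _) => //; exact: measurable_fun_pair1.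
rewrite integral_affine//; first by rewrite -fubini_tonelli2.
case: hal => [|[M gM]]; [by left|right].
apply: le_lt_trans (int_le _ M _ _ _) (ltry _) => // y.
by apply: int_le => //; exact: measurable_fun_pair1.
Qed.

(** * The Euclidean distance *)

Lemma enorm_continuous (R : realType) (n : nat) : continuous (@enorm R n).
Proof.
move=> u.
apply: (@continuous_comp _ _ _ (fun u : 'rV[R]_n => \sum_(i < n) u ord0 i ^+ 2) Num.sqrt).
  have gen (F : set_system 'rV[R]_n) : Filter F -> F --> u ->
      \sum_(i < n) x ord0 i ^+ 2 @[x --> F] --> \sum_(i < n) u ord0 i ^+ 2.
    move=> FF Fu; apply: (@cvg_big R^o) => [|i _]; first exact: add_continuous.
    have ci : x ord0 i @[x --> F] --> u ord0 i.
      exact: (@continuous_cvg _ _ _ F FF id _ u (@coord_continuous _ _ _ ord0 i u) Fu).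
    exact: (cvgM ci ci).
  by apply: (gen (nbhs u)).
exact: sqrt_continuous.
Qed.

Lemma dist_continuous (R : realType) (n : nat) :
  continuous (fun z : 'rV[R]_n * 'rV[R]_n => enorm (z.1 - z.2)).
Proof.
move=> z; apply: (@continuous_comp _ _ _ (fun z : 'rV[R]_n * 'rV[R]_n => z.1 - z.2)).
  by apply: cvgB; [exact: cvg_fst|exact: cvg_snd].
exact: enorm_continuous.
Qed.

Lemma enorm_ge0 (R : realType) (n : nat) (u : 'rV[R]_n) : 0 <= enorm u.
Proof. exact: sqrtr_ge0. Qed.

Lemma enorm_eq0 (R : realType) (n : nat) (u : 'rV[R]_n) : (enorm u == 0) = (u == 0).
Proof.
apply/eqP/eqP => [|->]; last first.
  by rewrite /enorm big1 ?sqrtr0// => i _; rewrite mxE expr0n.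
move=> /eqP; rewrite /enorm sqrtr_eq0 => le0; apply/rowP => i; rewrite mxE.
have s0 : \sum_(i < n) u ord0 i ^+ 2 = 0.
  by apply/eqP; rewrite eq_le le0 sumr_ge0// => j _; exact: sqr_ge0.
have /eqP := s0; rewrite psumr_eq0 => [|j _]; last exact: sqr_ge0.
by move=> /allP/(_ i (mem_index_enum _)); rewrite sqrf_eq0 => /eqP.
Qed.

Lemma enorm_diam (R : realType) (n : nat) (K : set 'rV[R]_n) : compact K ->
  exists2 D : R, 0 < D & forall x y, K x -> K y -> enorm (x - y) <= D.
Proof.
move=> hK.
have cKK := compact_setX hK hK.
have : compact [set enorm (z.1 - z.2) | z in K `*` K].
  by apply: continuous_compact cKK; apply: continuous_subspaceT; exact: dist_continuous.
move=> /compact_bounded[M [_ hM]].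
exists (`|M| + 1); first by rewrite ltr_wpDl.
move=> x y Kx Ky; rewrite -(ger0_norm (enorm_ge0 _)).
apply: hM; last by exists (x, y).
by have := ler_norm M; lra.
Qed.

Lemma measurable_coord (R : realType) (n : nat) (i : 'I_n) :
  measurable_fun setT (fun x : borel R n => (x : 'rV[R]_n) ord0 i).
Proof.
apply: measurability; first exact: RGenOInfty.measurableE.
move=> _ [ _ [a ->] <-]; rewrite setTI; apply: sub_sigma_algebra.
have -> : (fun x : borel R n => (x : 'rV[R]_n) ord0 i) @^-1` `]a, +oo[%classic =
    [set x : 'rV[R]_n | a < x ord0 i].
  by apply/seteqP; split => x /=; rewrite in_itv/= andbT.
exact: open_coord_gt.
Qed.

Lemma measurable_dist (R : realType) (n : nat) :
  measurable_fun setT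
    (fun z : borel R n * borel R n => enorm ((z.1 : 'rV[R]_n) - (z.2 : 'rV[R]_n))).
Proof.
rewrite /enorm; apply: measurableT_comp.
  exact: (continuous_measurable_fun (@sqrt_continuous R)).
apply: measurable_sum => i; apply: measurable_funX.
under eq_fun do rewrite !mxE.
apply: measurable_funB.
  by apply: (measurableT_comp (measurable_coord i)); exact: measurable_fst.
by apply: (measurableT_comp (measurable_coord i)); exact: measurable_snd.
Qed.

Lemma measurable_pot (R : realType) (r : R) : measurable_fun setT (pot r).
Proof.
rewrite /pot; apply: measurable_fun_ifT => //.
- by apply: measurable_and => //; exact: measurable_fun_eqr.
- apply/measurable_EFinP; rewrite /potr; case: eqP => _.
    by apply: measurableT_comp => //; exact: measurable_ln.
  apply: measurable_funM => //; by apply: measurable_funB => //.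
Qed.

(** * Shifted kernels *)

(** The kernel h_r(|x - y|) + C, with the distance cut at D: on a set of diameter
    at most D the cut changes nothing, and it keeps the kernel nonnegative on the
    whole space. *)
Definition gker (R : realType) (n : nat) (D C r : R) (z : borel R n * borel R n) : \bar R :=
  (pot r (Num.min (enorm ((z.1 : 'rV[R]_n) - (z.2 : 'rV[R]_n))) D) + C%:E)%E.

Section Kernel.
Variables (R : realType) (n : nat) (D C : R).
Hypothesis D0 : 0 < D.
Implicit Types (r s p : R) (z : borel R n * borel R n).

Let dist z : R := Num.min (enorm ((z.1 : 'rV[R]_n) - (z.2 : 'rV[R]_n))) D.

Lemma dist_ge0 z : 0 <= dist z.
Proof. by rewrite /dist le_min enorm_ge0 ltW. Qed.

Lemma dist_le z : dist z <= D.
Proof. by rewrite /dist ge_min lexx orbT. Qed.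

Lemma measurable_gker r : measurable_fun setT (gker (n := n) D C r).
Proof.
apply: emeasurable_funD; last exact: measurable_cst.
apply: (measurableT_comp (measurable_pot r)).
by apply: measurable_minr; [exact: measurable_dist|exact: measurable_cst].
Qed.

Lemma le_gker r s z : r <= s -> (gker D C r z <= gker D C s z)%E.
Proof. by move=> rs; rewrite leeD2r// le_pot// dist_ge0. Qed.

Lemma gker_ge r z : ((potr r D + C)%:E <= gker D C r z)%E.
Proof.
rewrite EFinD leeD2r// -(potE r D0).
by rewrite pot_anti ?dist_ge0 ?dist_le.
Qed.

Lemma gker_ge0 r0 r z : C = - potr r0 D -> r0 <= r -> (0 <= gker D C r z)%E.
Proof.
move=> CE r0r; apply: le_trans (gker_ge r z); rewrite lee_fin CE subr_ge0.
by rewrite -lee_fin -!potE// le_pot// ltW.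
Qed.

Lemma gker_le_neg r z : r < 0 -> (gker D C r z <= (- r^-1 + C)%:E)%E.
Proof.
move=> r0; rewrite EFinD leeD2r//.
rewrite -(potr0 r0) -[leRHS]/((potr r 0)%:E).
have -> : (potr r 0)%:E = pot r 0 by rewrite /pot leNgt r0.
by rewrite pot_anti ?dist_ge0.
Qed.

Lemma gker_lsc (K : set 'rV[R]_n) r : lsc_on K (gker D C r : 'rV[R]_n * 'rV[R]_n -> \bar R).
Proof.
move=> x y a _ _; rewrite /gker -lteBlDr// -EFinB => /pot_lsc[|t' lt' at'].
  exact: (dist_ge0 (x, y)).
have : \forall w \near (x, y), Num.min (enorm (w.1 - w.2)) D < t'.
  have cv : {for (x, y), continuous (fun w : 'rV[R]_n * 'rV[R]_n => Num.min (enorm (w.1 - w.2)) D)}.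
    apply: (@continuous_comp _ _ _ (fun w : 'rV[R]_n * 'rV[R]_n => enorm (w.1 - w.2)) (fun t => Num.min t D)).
      exact: dist_continuous.
    by apply: continuous_min; [exact: cvg_id|exact: cvg_cst].
  exact: (cvgr_lt _ cv).
move=> [[N M] /= [Nx My] NM]; exists N, M; split => // x' y' Nx' My' _ _.
rewrite -lteBlDr// -EFinB; apply: (lt_le_trans at').
by apply: pot_anti; [exact: (dist_ge0 (x', y'))|apply: ltW; exact: (NM (x', y'))].
Qed.

Lemma gker_left p z (a : R) : (a%:E < gker D C p z)%E ->
  exists2 r, r < p & (a%:E < gker D C r z)%E.
Proof.
rewrite /gker -lteBlDr// -EFinB => /pot_left[|r rp ar]; first exact: dist_ge0.
by exists r => //; rewrite -lteBlDr// -EFinB.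
Qed.

Lemma gker_right p ps (u : nat -> R) z : (p < 0 -> ps < 0) ->
  (forall k, p <= u k <= ps) -> u @ \oo --> p ->
  gker D C (u k) z @[k --> \oo] --> gker D C p z.
Proof.
move=> pps up ucv; rewrite /gker -/(dist z); have := dist_ge0 z.
rewrite le_eqVlt => /orP[/eqP <-|t0]; last first.
  rewrite potE// -EFinD.
  rewrite (_ : (fun k => _) = EFin \o (fun k => potr (u k) (dist z) + C)); last first.
    by apply/funext => k /=; rewrite potE.
  apply: cvg_EFin; first by apply: nearW.
  apply: cvgD; last exact: cvg_cst.
  apply: (@continuous_cvg _ _ _ _ _ u (fun r => potr r (dist z)) p _ ucv); exact: potr_continuous.
have [p0|p0] := leP 0 p.
  apply: cvg_near_cst; apply: nearW => k.
  have /andP[pu _] := up k.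
  by rewrite /pot eqxx !andbT p0 (le_trans p0 pu).
have s0 := pps p0; have u0 k : u k < 0 by have /andP[_] := up k => /le_lt_trans; apply.
rewrite /pot eqxx andbT leNgt p0/= potr0// -EFinD.
rewrite (_ : (fun k => _) = EFin \o (fun k => - (u k)^-1 + C)); last first.
  by apply/funext => k /=; rewrite andbT leNgt u0/= potr0.
apply: cvg_EFin; first by apply: nearW.
apply: cvgD; last exact: cvg_cst.
by apply: cvgN; apply: cvgV => //; rewrite lt_eqF.
Qed.

End Kernel.

(** * Capacity through shifted energies *)

(** If F = al * E + be, comparing an extremum of F with x is comparing the infimum
    of E with (x - be) / al; the extremum of F is its infimum for al > 0 and its
    supremum for al < 0. *)
Section Affine.
Variable R : realType.
Implicit Types (al be x : R) (e : \bar R).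

Lemma affine_lt_pos al be x e : 0 < al ->
  (al%:E * e + be%:E < x%:E)%E = (e < ((x - be) / al)%:E)%E.
Proof.
move=> a0; case: e => [e| |].
- by rewrite -EFinM -EFinD !lte_fin ltr_pdivlMr// -ltrBrDr [e * al]mulrC.
- by rewrite gt0_muley ?lte_fin// addye.
- by rewrite gt0_muleNy ?lte_fin// addNye !ltNyr.
Qed.

Lemma affine_gt_neg al be x e : al < 0 ->
  (x%:E < al%:E * e + be%:E)%E = (e < ((x - be) / al)%:E)%E.
Proof.
move=> a0; case: e => [e| |].
- by rewrite -EFinM -EFinD !lte_fin ltr_ndivlMr// -ltrBlDr [e * al]mulrC.
- by rewrite lt0_muley ?lte_fin// addNye.
- by rewrite lt0_muleNy ?lte_fin// addye// ltry ltNyr.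
Qed.

Variables (T : Type) (P : set T) (F E : T -> \bar R) (al be x : R).
Hypothesis FE : forall t, P t -> F t = (al%:E * E t + be%:E)%E.

Lemma inf_affine_lt : 0 < al -> (ereal_inf [set F t | t in P] < x%:E)%E <->
  exists2 t, P t & (E t < ((x - be) / al)%:E)%E.
Proof.
move=> a0; split.
  by move=> /ereal_inf_lt[_ [t Pt <-]]; rewrite FE// affine_lt_pos//; exists t.
move=> [t Pt]; rewrite -affine_lt_pos// -FE//; apply: le_lt_trans.
by apply: ereal_inf_lbound; exists t.
Qed.

Lemma inf_affine_gt : 0 < al -> (x%:E < ereal_inf [set F t | t in P])%E <->
  exists2 d : R, (x - be) / al < d & forall t, P t -> (d%:E <= E t)%E.
Proof.
move=> a0; split.
  move=> /ereal_between[y [xy yF]]; exists ((y - be) / al).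
    by rewrite ltr_pM2r ?invr_gt0// ltrD2r -lte_fin.
  move=> t Pt; rewrite leNgt -affine_lt_pos// -leNgt -FE// ltW//.
  by apply: (lt_le_trans yF); apply: ereal_inf_lbound; exists t.
move=> [d xd dE]; apply: (@lt_le_trans _ _ (al * d + be)%:E).
  by rewrite lte_fin -ltrBlDr [al * d]mulrC -ltr_pdivrMr.
apply: le_ereal_inf_tmp => _ [t Pt <-]; rewrite FE// leNgt affine_lt_pos//.
by rewrite addrK mulrC mulKf ?gt_eqF// -leNgt dE.
Qed.

Lemma sup_affine_gt : al < 0 -> (x%:E < ereal_sup [set F t | t in P])%E <->
  exists2 t, P t & (E t < ((x - be) / al)%:E)%E.
Proof.
move=> a0; split.
  by move=> /ereal_sup_gt[_ [t Pt <-]]; rewrite FE// affine_gt_neg//; exists t.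
move=> [t Pt]; rewrite -affine_gt_neg// -FE// => h; apply: (lt_le_trans h).
by apply: ereal_sup_ubound; exists t.
Qed.

Lemma sup_affine_lt : al < 0 -> (ereal_sup [set F t | t in P] < x%:E)%E <->
  exists2 d : R, (x - be) / al < d & forall t, P t -> (d%:E <= E t)%E.
Proof.
move=> a0; split.
  move=> /ereal_between[y [Fy yx]]; exists ((y - be) / al).
    by rewrite ltr_nM2r ?invr_lt0// ltrD2r -lte_fin.
  move=> t Pt; rewrite leNgt -affine_gt_neg// -leNgt -FE// ltW//.
  by apply: le_lt_trans Fy; apply: ereal_sup_ubound; exists t.
move=> [d xd dE]; apply: (@le_lt_trans _ _ (al * d + be)%:E); last first.
  by rewrite lte_fin -ltrBrDr [al * d]mulrC -ltr_ndivrMr.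
apply: ge_ereal_sup => _ [t Pt <-]; rewrite FE// leNgt affine_gt_neg//.
by rewrite addrK mulrC mulKf ?lt_eqF// -leNgt dE.
Qed.

End Affine.

Lemma lt_powR_inv (R : realType) (c v r : R) : 0 < c -> 0 < v -> 0 < r ->
  (c < v `^ (- r^-1)) = (v < c `^ (- r)).
Proof.
move=> c0 v0 r0; rewrite /powR !gt_eqF//.
rewrite -[in LHS](lnK (x := c)) ?posrE// -[in RHS](lnK (x := v)) ?posrE//.
by rewrite !ltr_expR mulNr ltrNr mulNr ltr_pdivrMl// mulrN.
Qed.

Lemma gt_powR_inv (R : realType) (c v r : R) : 0 < c -> 0 < v -> 0 < r ->
  (v `^ (- r^-1) < c) = (c `^ (- r) < v).
Proof.
move=> c0 v0 r0; rewrite /powR !gt_eqF//.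
rewrite -[in LHS](lnK (x := c)) ?posrE// -[in RHS](lnK (x := v)) ?posrE//.
by rewrite !ltr_expR mulNr ltrNl mulNr ltr_pdivlMl// mulrN.
Qed.

Lemma lt_powR_invN (R : realType) (c v r : R) : 0 < c -> 0 <= v -> r < 0 ->
  (c < v `^ (- r^-1)) = (c `^ (- r) < v).
Proof.
move=> c0 v0 r0; move: v0; rewrite le_eqVlt => /orP[/eqP <-|v0].
  rewrite powR0 ?oppr_eq0 ?invr_eq0 ?lt_eqF//.
  by rewrite !ltNge powR_ge0 ltW.
rewrite -invrN; have : 0 < - r by rewrite oppr_gt0.
move: (- r) => s s0; rewrite /powR !gt_eqF//.
rewrite -[in LHS](lnK (x := c)) ?posrE// -[in RHS](lnK (x := v)) ?posrE//.
by rewrite !ltr_expR ltr_pdivlMl.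
Qed.

Lemma gt_powR_invN (R : realType) (c v r : R) : 0 < c -> 0 <= v -> r < 0 ->
  (v `^ (- r^-1) < c) = (v < c `^ (- r)).
Proof.
move=> c0 v0 r0; move: v0; rewrite le_eqVlt => /orP[/eqP <-|v0].
  rewrite powR0 ?oppr_eq0 ?invr_eq0 ?lt_eqF//.
  by rewrite c0 powR_gt0.
rewrite -invrN; have : 0 < - r by rewrite oppr_gt0.
move: (- r) => s s0; rewrite /powR !gt_eqF//.
rewrite -[in LHS](lnK (x := c)) ?posrE// -[in RHS](lnK (x := v)) ?posrE//.
by rewrite !ltr_expR ltr_pdivrMl.
Qed.

Lemma powR_potr (R : realType) (C r c : R) : r != 0 ->
  (c `^ (- r) - (1 - r * C)) / r = potr r c + C.
Proof. by move=> rn0; rewrite /potr (negbTE rn0); field. Qed.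

Lemma prob_square_cst d (T : measurableType d) (R : realType) (P : probability T R) (c : R) :
  (\int[(P \x P)%E]_z (cst c%:E) z = c%:E)%E.
Proof.
have m1 : (P \x P)%E setT = 1%E.
  rewrite -setXTT; apply: (etrans (product_measure1E _ _ measurableT measurableT)).
  by rewrite -[RHS]mule1; congr (_ * _)%E; exact: probability_setT.
by rewrite -[RHS]mule1 -m1; exact: integral_cst.
Qed.

(** D bounds the distances in K, and r0 is a lower bound for the exponents under
    consideration: C makes all the kernels with exponent at least r0 nonnegative. *)
Section CapacityChar.
Variables (R : realType) (n : nat) (K : set 'rV[R]_n) (D C r0 : R).
Hypothesis hK : compact K.
Hypothesis K0 : K <> set0.
Hypothesis D0 : 0 < D.
Hypothesis hD : forall x y, K x -> K y -> enorm (x - y) <= D.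
Hypothesis CE : C = - potr r0 D.

Definition pot_energy (r : R) (mu : probability (borel R n) R) : \bar R :=
  (\int[(mu \x mu)%E]_z gker D C r z)%E.

Lemma pot_energy_ge r mu : r0 <= r -> ((potr r D + C)%:E <= pot_energy r mu)%E.
Proof.
move=> rr; rewrite -(prob_square_cst mu (potr r D + C)).
apply: ge0_le_integral => //.
- by move=> z _; rewrite lee_fin CE subr_ge0 -lee_fin -!potE// le_pot// ltW.
- exact: measurable_gker.
- by move=> z _; exact: gker_ge.
Qed.

Lemma riesz_energyE r mu : r0 <= r -> r != 0 -> prob_on K mu ->
  energy K (riesz_kernel r) mu = (r%:E * pot_energy r mu + (1 - r * C)%:E)%E.
Proof.
move=> rr rn0 muK; apply: energy_affine => //.
- exact: measurable_gker.
- by move=> z; exact: gker_ge0 rr.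
- have [r_lt0|r_gt0|r_eq0] := ltgtP r 0; [right|by left|by rewrite r_eq0 eqxx in rn0].
  by exists (- r^-1 + C) => z; exact: gker_le_neg.
move=> x y Kx Ky; rewrite /gker/= min_l ?hD// /riesz_kernel.
rewrite /pot enorm_eq0 subr_eq0 [0 <= r]le_eqVlt [0 == r]eq_sym (negbTE rn0)/=.
case: ifP => [/andP[r_gt0 _]|_].
  by rewrite addye// gt0_muley ?lte_fin// addye.
rewrite -!EFinD; congr EFin.
by rewrite /potr (negbTE rn0) mulrDr mulrC divfK//; ring.
Qed.

Lemma log_energyE mu : r0 <= 0 -> prob_on K mu ->
  energy K (@log_kernel R n) mu = (1%:E * pot_energy 0 mu + (- C)%:E)%E.
Proof.
move=> rr muK; apply: energy_affine => //.
- exact: measurable_gker.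
- by move=> z; exact: gker_ge0 rr.
- by left.
move=> x y Kx Ky; rewrite /gker/= min_l ?hD// /log_kernel mul1e.
rewrite /pot lexx enorm_eq0 subr_eq0/=; case: eqP => [_|/eqP xy].
  by rewrite addye// addye.
rewrite -!EFinD; congr EFin; rewrite /potr eqxx div1r lnV ?addrK//.
by rewrite posrE lt_neqAle enorm_ge0 eq_sym enorm_eq0 subr_eq0 xy.
Qed.

Let coef r c : r != 0 -> (c `^ (- r) - (1 - r * C)) / r = potr r c + C.
Proof. exact: powR_potr. Qed.

Lemma pot_energy_ge0 r mu : r0 <= r -> (0 <= pot_energy r mu)%E.
Proof. by move=> rr; apply: integral_ge0 => z _; exact: gker_ge0 rr. Qed.

(** The energy is at least D^-r, hence positive, and V^(-1/r) is a decreasing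
    function of V > 0 whose value at infinity is 0. *)
Lemma capacity_pos r c : r0 <= r -> 0 < r -> 0 < c ->
  ((c < capacity K r) = (riesz_energy K r < (c `^ (- r))%:E)%E) /\
  ((capacity K r < c) = ((c `^ (- r))%:E < riesz_energy K r)%E).
Proof.
move=> rr rp c0; have rn0 : r != 0 by rewrite gt_eqF.
have V0 : (0%:E < riesz_energy K r)%E.
  rewrite /riesz_energy rp.
  apply/(inf_affine_gt 0 (fun mu => @riesz_energyE r mu rr rn0)) => //.
  (* D bounds the distances, so h_r(D) + C is a lower bound of all energies. *)
  exists (potr r D + C) => [|mu _]; last exact: pot_energy_ge.
  rewrite -(coef D rn0) ltr_pM2r ?invr_gt0// ltrD2r powR_gt0//.
rewrite /capacity (negbTE rn0); case: (riesz_energy K r) V0 => [v| |] //.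
- by rewrite !lte_fin => v0; rewrite lt_powR_inv// gt_powR_inv.
- by move=> _; rewrite ltry c0 [c < 0]ltNge (ltW c0) ltNge leey.
Qed.

Lemma capacity_zero c : r0 <= 0 -> 0 < c ->
  ((c < capacity K 0) = (log_energy K < (- ln c)%:E)%E) /\
  ((capacity K 0 < c) = ((- ln c)%:E < log_energy K)%E).
Proof.
move=> rr c0.
have V0 : ((- ln D - 1)%:E < log_energy K)%E.
  apply/(inf_affine_gt _ (fun mu => @log_energyE mu rr)) => //.
  exists (potr 0 D + C) => [|mu _]; last exact: pot_energy_ge.
  by rewrite divr1 opprK /potr eqxx; lra.
rewrite /capacity eqxx; case: (log_energy K) V0 => [v| |] // _.
- have cE : c = expR (ln c) by rewrite lnK.
  rewrite !lte_fin; split; first by rewrite {1}cE ltr_expR ltrNr.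
  by rewrite {1}cE ltr_expR ltrNl.
- by rewrite ltry c0 [c < 0]ltNge (ltW c0) ltNge leey.
Qed.

(** V is finite and nonnegative as a supremum of energies of a bounded nonnegative
    kernel, and V^(-1/r) is an increasing function of V >= 0. *)
Lemma capacity_neg r c : r0 <= r -> r < 0 -> 0 < c ->
  ((c < capacity K r) = ((c `^ (- r))%:E < riesz_energy K r)%E) /\
  ((capacity K r < c) = (riesz_energy K r < (c `^ (- r))%:E)%E).
Proof.
move=> rr rneg c0; have rn0 : r != 0 by rewrite lt_eqF.
have Ey : (riesz_energy K r < (2 - r * C)%:E)%E.
  rewrite /riesz_energy [0 < r]ltNge (ltW rneg)/= asboolF//.
  (* All energies are at most 1 - r * C, as the shifted ones are at least 0. *)
  apply/(sup_affine_lt _ (fun mu => @riesz_energyE r mu rr rn0)) => //.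
  exists 0 => [|mu _]; last exact: pot_energy_ge0.
  by rewrite ltr_ndivrMr// mul0r; lra.
have V0 v : riesz_energy K r = v%:E -> 0 <= v.
  rewrite /riesz_energy [0 < r]ltNge (ltW rneg)/= asboolF// => Vv.
  have : (ereal_sup (energies K (riesz_kernel r)) > (v - 1)%:E)%E by rewrite Vv lte_fin; lra.
  move=> /ereal_sup_gt[_ [mu muK <-] _]; rewrite -lee_fin -Vv.
  apply: (@le_trans _ _ (energy K (riesz_kernel r) mu)); last by apply: ereal_sup_ubound; exists mu.
  apply: integral_ge0 => y _; apply: integral_ge0 => x _.
  by rewrite /riesz_kernel; case: ifP => // _; rewrite lee_fin powR_ge0.
rewrite /capacity (negbTE rn0); case: (riesz_energy K r) Ey V0 => [v| |] // _ V0.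
- have v0 := V0 v erefl.
  by rewrite !lte_fin (lt_powR_invN c0 v0 rneg) (gt_powR_invN c0 v0 rneg).
- by rewrite ltNyr c0 [c < 0]ltNge (ltW c0) ltNge leNye.
Qed.

(** The comparison has the same form for r < 0, r = 0 and r > 0, which is what allows
    exponents of different signs to be compared near r = 0. *)
Theorem lt_capacity r c : r0 <= r -> 0 < c -> c < capacity K r <->
  exists2 mu, prob_on K mu & (pot_energy r mu < (potr r c + C)%:E)%E.
Proof.
move=> rr c0; have [rneg|rpos|re] := ltgtP r 0.
- have rn0 : r != 0 by rewrite lt_eqF.
  rewrite (capacity_neg rr rneg c0).1 /riesz_energy [0 < r]ltNge (ltW rneg)/= asboolF//.
  by rewrite -(coef c rn0); apply: (sup_affine_gt _ (fun mu => @riesz_energyE r mu rr rn0)).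
- have rn0 : r != 0 by rewrite gt_eqF.
  rewrite (capacity_pos rr rpos c0).1 /riesz_energy rpos.
  by rewrite -(coef c rn0); apply: (inf_affine_lt _ (fun mu => @riesz_energyE r mu rr rn0)).
rewrite re in rr *; rewrite (capacity_zero rr c0).1.
have -> : potr 0 c + C = (- ln c - - C) / 1 by rewrite divr1 opprK /potr eqxx.
by apply: (inf_affine_lt _ (fun mu => @log_energyE mu rr)).
Qed.

(** As the infimum over the measures is compared strictly, a gap d is needed. *)
Theorem capacity_lt r c : r0 <= r -> 0 < c -> capacity K r < c <->
  exists2 d, potr r c + C < d & forall mu, prob_on K mu -> (d%:E <= pot_energy r mu)%E.
Proof.
move=> rr c0; have [rneg|rpos|re] := ltgtP r 0.
- have rn0 : r != 0 by rewrite lt_eqF.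
  rewrite (capacity_neg rr rneg c0).2 /riesz_energy [0 < r]ltNge (ltW rneg)/= asboolF//.
  by rewrite -(coef c rn0); apply: (sup_affine_lt _ (fun mu => @riesz_energyE r mu rr rn0)).
- have rn0 : r != 0 by rewrite gt_eqF.
  rewrite (capacity_pos rr rpos c0).2 /riesz_energy rpos.
  by rewrite -(coef c rn0); apply: (inf_affine_gt _ (fun mu => @riesz_energyE r mu rr rn0)).
rewrite re in rr *; rewrite (capacity_zero rr c0).2.
have -> : potr 0 c + C = (- ln c - - C) / 1 by rewrite divr1 opprK /potr eqxx.
by apply: (inf_affine_gt _ (fun mu => @log_energyE mu rr)).
Qed.

End CapacityChar.

(** * One-sided continuity of the capacity *)

Lemma cvg_order (R : realType) (T : Type) (F : set_system T) (f : T -> R) (l : R) :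
  Filter F -> (forall c, c < l -> \forall t \near F, c < f t) ->
  (forall c, l < c -> \forall t \near F, f t < c) -> f @ F --> l.
Proof.
move=> FF hl hu; apply/cvgrPdist_lt => e e0.
have h1 : l - e < l by lra.
have h2 : l < l + e by lra.
near=> t; rewrite distrC ltr_distl; apply/andP; split; near: t; [exact: hl|exact: hu].
Unshelve. all: by end_near. Qed.

Lemma capacity_ge0 (R : realType) (n : nat) (K : set 'rV[R]_n) r : 0 <= capacity K r.
Proof.
rewrite /capacity; case: ifP => _; first by case: log_energy => // v; exact: expR_ge0.
by case: riesz_energy => // v; exact: powR_ge0.
Qed.

Section Continuity.
Variables (R : realType) (n : nat) (K : set 'rV[R]_n) (D C r0 : R).
Hypothesis hK : compact K.
Hypothesis K0 : K <> set0.
Hypothesis D0 : 0 < D.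
Hypothesis hD : forall x y, K x -> K y -> enorm (x - y) <= D.
Hypothesis CE : C = - potr r0 D.

Let E := @pot_energy R n D C.

Lemma le_pot_energy r s mu : r0 <= r -> r <= s -> (E r mu <= E s mu)%E.
Proof.
move=> rr rs; apply: ge0_le_integral => //.
- by move=> z _; exact: (gker_ge0 D0 z CE rr).
- exact: measurable_gker.
- exact: measurable_gker.
- by move=> z _; exact: le_gker.
Qed.

(** Otherwise measures with energy below d' exist for exponents u k increasing to p.
    Their limit measure has energy at most d' for every exponent u j, hence for p
    by Fatou's lemma. *)
Lemma pot_energy_left p (d d' : R) : r0 < p -> d' < d ->
  (forall mu, prob_on K mu -> (d%:E <= E p mu)%E) ->
  exists2 r1, r0 <= r1 < p & forall mu, prob_on K mu -> (d'%:E <= E r1 mu)%E.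
Proof.
move=> rp dd hp; apply: contrapT => no.
pose u (k : nat) := p - (p - r0) / k.+1%:R.
have pr : 0 < p - r0 by rewrite subr_gt0.
have u_lt k : u k < p by rewrite /u ltrBlDr ltrDl divr_gt0.
have u_ge k : r0 <= u k.
  by rewrite /u lerBrDl -lerBrDr ler_pdivrMr// ler_peMr ?ler1n// ltW.
have u_mono j k : (j <= k)%N -> u j <= u k.
  by move=> jk; rewrite /u lerD2l lerN2 ler_pM2l// lef_pV2 ?posrE// ler_nat.
have u_near r : r < p -> exists i, forall j, (i <= j)%N -> r <= u j.
  move=> rlt; have pr' : 0 < p - r by rewrite subr_gt0.
  exists (Num.truncn ((p - r0) / (p - r))).+1 => j ij.
  rewrite /u lerBrDl -lerBrDr ler_pdivrMr// -ler_pdivrMl// mulrC.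
  apply: ltW; apply: (lt_le_trans (truncnS_gt _)); rewrite ler_nat.
  exact: leqW.
have /choice[mu_ hmu] : forall k, exists mu, prob_on K mu /\ (E (u k) mu < d'%:E)%E.
  move=> k; apply: contrapT => h; apply: no; exists (u k); first by rewrite u_ge u_lt.
  by move=> mu muK; rewrite leNgt; apply/negP => lt; apply: h; exists mu.
have [mu [muK hle]] := energy_compactness hK (fun k => (hmu k).1).
have Eu j : (E (u j) mu <= d'%:E)%E.
  apply: hle; [exact: measurable_gker|by move=> z; exact: (gker_ge0 D0 z CE (u_ge j))|exact: gker_lsc|].
  exists j => k jk; apply: (@le_trans _ _ (E (u k) (mu_ k))).
    by apply: le_pot_energy; [exact: u_ge|exact: u_mono].
  by apply: ltW; have [] := hmu k.
suff : (E p mu <= d'%:E)%E.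
  by move=> /(le_trans (hp _ muK)); rewrite lee_fin leNgt dd.
have fat : (\int[(mu \x mu)%E]_z limn_einf (fun j => gker D C (u j) z) <= d'%:E)%E.
  apply: (@le_trans _ _ (limn_einf (fun j => E (u j) mu))); last exact: limn_einf_le.
  apply: fatou => //; first by move=> j; exact: measurable_gker.
  by move=> j z _; exact: (gker_ge0 D0 z CE (u_ge j)).
apply: le_trans fat; apply: ge0_le_integral => //.
- by move=> z _; exact: (gker_ge0 D0 z CE (ltW rp)).
- exact: measurable_gker.
- by apply: measurable_fun_limn_einf => j; exact: measurable_gker.
move=> z _; apply: limn_einf_ge => a ap.
have [r rlt ar] := gker_left D0 ap.
have [i hi] := u_near _ rlt; exists i => j /hi ruj.
by apply: (le_trans (ltW ar)); exact: le_gker.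
Qed.

(** Dominated convergence along u k decreasing to p, dominated by the kernel of
    exponent ps.  The condition on signs ensures convergence on the diagonal: for
    p < 0 the kernel is finite there, and so must be those that approach it. *)
Lemma pot_energy_right p ps mu (x : R) : r0 <= p -> p < ps -> (p < 0 -> ps < 0) ->
  (E ps mu < +oo)%E -> (E p mu < x%:E)%E ->
  exists2 r1, p < r1 & (E r1 mu < x%:E)%E.
Proof.
move=> rp pps pneg Efin Ex.
pose u (k : nat) := p + (ps - p) / k.+1%:R.
have pp : 0 < ps - p by rewrite subr_gt0.
have u_gt k : p < u k by rewrite /u ltrDl divr_gt0.
have u_le k : u k <= ps.
  by rewrite /u -lerBrDl ler_pdivrMr// ler_peMr ?ler1n// ltW.
have ucv : u @ \oo --> p.
  rewrite -[X in _ --> X]addr0 -[X in _ + X](mulr0 (ps - p)).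
  apply: cvgD; first exact: cvg_cst.
  by apply: cvgM; [exact: cvg_cst|exact: cvg_harmonic].
have r_u k : r0 <= u k by rewrite (le_trans rp)// ltW.
have cvE : (fun k => E (u k) mu) @ \oo --> E p mu.
  have [| | | | |_ _ //] := @dominated_convergence _ _ R (mu \x mu)%E setT measurableT
    (fun k => gker D C (u k)) (gker D C p) (gker D C ps).
  - by move=> k; exact: measurable_gker.
  - exact: measurable_gker.
  - apply: aeW => z _; have hu k : p <= u k <= ps by rewrite u_le ltW.
    exact: (gker_right D0 pneg hu ucv).
  - apply/integrableP; split; first exact: measurable_gker.
    under eq_integral do rewrite gee0_abs ?(gker_ge0 D0 _ CE (le_trans rp (ltW pps)))//.
    exact: Efin.
  - apply: aeW => z k _; rewrite gee0_abs ?(gker_ge0 D0 _ CE (r_u k))//.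
    exact: le_gker.
apply: contrapT => no.
have : (x%:E <= E p mu)%E.
  apply: (cvge_to_ge cvE); apply: nearW => k; rewrite leNgt; apply/negP => lt.
  by apply: no; exists (u k).
by rewrite leNgt Ex.
Qed.

Lemma pot_energy_neg_lty r mu : r0 <= r -> r < 0 -> (E r mu < +oo)%E.
Proof.
move=> rr rneg.
apply: (@le_lt_trans _ _ (\int[(mu \x mu)%E]_z (cst (- r^-1 + C)%:E) z)%E).
  apply: ge0_le_integral => //.
  - by move=> z _; exact: (gker_ge0 D0 z CE rr).
  - exact: measurable_gker.
  - by move=> z _; exact: gker_le_neg.
rewrite prob_square_cst ltry//.
Qed.

(** Monotonicity in the exponent keeps the capacity above any c below its value at p,
    up to the continuous variation of h_r(c); the other inequality is
    [pot_energy_left]. *)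
Lemma capacity_left p : r0 < p -> capacity K r @[r --> p^'-] --> capacity K p.
Proof.
move=> rp; have near_r : \forall r \near p^'-, r0 < r by exact: nbhs_left_gt.
have cpot c : 0 < c -> potr r c + C @[r --> p^'-] --> potr p c + C.
  move=> c0; apply: cvgD; last exact: cvg_cst.
  exact: cvg_at_left_filter (potr_continuous c0 (x := p)).
apply: cvg_order => c.
  move=> cp; have [c_lt0|c_ge0] := ltP c 0.
    by apply: nearW => r; apply: lt_le_trans c_lt0 _; exact: capacity_ge0.
  have [c' /andP[cc' c'p] c'0] : exists2 c', c < c' < capacity K p & 0 < c'.
    by exists ((c + capacity K p) / 2); [apply/andP; split|]; lra.
  have /(lt_capacity hK K0 D0 hD CE (ltW rp) c'0)[mu muK /ereal_between[x [Ex xc]]] := c'p.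
  rewrite lte_fin in xc; near=> r; apply: (lt_trans cc').
  have rr : r0 < r by near: r.
  apply/(lt_capacity hK K0 D0 hD CE (ltW rr) c'0); exists mu => //.
  apply: (le_lt_trans (le_pot_energy mu (ltW rr) _)); first by apply: ltW; near: r; exact: nbhs_left_lt.
  by apply: (lt_trans Ex); rewrite lte_fin; near: r; exact: (cvgr_gt _ (cpot c' c'0)).
move=> pc; have c0 : 0 < c by apply: le_lt_trans pc; exact: capacity_ge0.
have /(capacity_lt hK K0 D0 hD CE (ltW rp) c0)[d dc hd] := pc.
have d1 : (potr p c + C + d) / 2 < d by lra.
have d2 : potr p c + C < (potr p c + C + d) / 2 by lra.
have [r1 /andP[rr1 r1p] hr1] := pot_energy_left rp d1 hd.
near=> r.
have r1r : r1 < r by near: r; exact: nbhs_left_gt.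
have rr : r0 <= r by apply: (le_trans rr1); exact: ltW.
apply/(capacity_lt hK K0 D0 hD CE rr c0); exists ((potr p c + C + d) / 2).
  by near: r; exact: (cvgr_lt _ (cpot c c0)).
move=> mu muK; apply: (le_trans (hr1 _ muK)).
by apply: le_pot_energy => //; exact: ltW.
Unshelve. all: by end_near. Qed.

(** Here monotonicity in the exponent gives the upper bound.  For the lower bound,
    the measures given by the hypothesis have energies that vary continuously on
    the right of p. *)
Lemma capacity_right p ps : r0 < p -> p < ps -> (p < 0 -> ps < 0) ->
  (forall c, 0 < c -> c < capacity K p -> exists mu, [/\ prob_on K mu,
     (E p mu < (potr p c + C)%:E)%E & (E ps mu < +oo)%E]) ->
  capacity K r @[r --> p^'+] --> capacity K p.
Proof.
move=> rp pps pneg hmu.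
have near_r : \forall r \near p^'+, p < r by exact: nbhs_right_gt.
have cpot c : 0 < c -> potr r c + C @[r --> p^'+] --> potr p c + C.
  move=> c0; apply: cvgD; last exact: cvg_cst.
  exact: cvg_at_right_filter (potr_continuous c0 (x := p)).
apply: cvg_order => c.
  move=> cp; have [c_lt0|c_ge0] := ltP c 0.
    by apply: nearW => r; apply: lt_le_trans c_lt0 _; exact: capacity_ge0.
  have [c' /andP[cc' c'p] c'0] : exists2 c', c < c' < capacity K p & 0 < c'.
    by exists ((c + capacity K p) / 2); [apply/andP; split|]; lra.
  have [mu [muK /ereal_between[x [Ex xc]] Eps]] := hmu _ c'0 c'p.
  have [r1 pr1 Er1] := pot_energy_right (ltW rp) pps pneg Eps Ex.
  rewrite lte_fin in xc; near=> r; apply: (lt_trans cc').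
  have pr : p < r by near: r.
  have rr := lt_trans rp pr.
  apply/(lt_capacity hK K0 D0 hD CE (ltW rr) c'0); exists mu => //.
  apply: (@le_lt_trans _ _ (E r1 mu)).
    by apply: le_pot_energy (ltW rr) _; apply: ltW; near: r; exact: nbhs_right_lt.
  by apply: (lt_trans Er1); rewrite lte_fin; near: r; exact: (cvgr_gt _ (cpot c' c'0)).
move=> pc; have c0 : 0 < c by apply: le_lt_trans pc; exact: capacity_ge0.
have /(capacity_lt hK K0 D0 hD CE (ltW rp) c0)[d dc hd] := pc.
near=> r; have pr : p < r by near: r.
have rr := lt_trans rp pr.
apply/(capacity_lt hK K0 D0 hD CE (ltW rr) c0); exists d.
  by near: r; exact: (cvgr_lt _ (cpot c c0)).
move=> mu muK; apply: (le_trans (hd _ muK)).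
by apply: le_pot_energy; exact: ltW.
Unshelve. all: by end_near. Qed.

End Continuity.

Lemma capacity_set0 (R : realType) (n : nat) (r : R) : capacity (@set0 'rV[R]_n) r = 0.
Proof.
have e0 k : energies (@set0 'rV[R]_n) k = set0.
  apply/seteqP; split => // x [mu mu1 _]; move: mu1.
  by rewrite /prob_on measure0 => /eqP; rewrite eq_sym onee_eq0.
rewrite /capacity /log_energy /riesz_energy !e0 ereal_inf0 asboolT//.
case: (ltgtP r 0) => // r0.
by rewrite /= powR0// oppr_eq0 invr_eq0 lt_eqF.
Qed.

Theorem theorem1p3 (R : realType) (n : nat) (hn : (0 < n)%N)
    (K : set 'rV[R]_n) (hK : compact K) :
  [/\ (forall p : R, p < 0 -> {for p, continuous (capacity K)}),
      (forall p : R, capacity K r @[r --> p^'-] --> capacity K p)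
    & (forall (p : R) (mu : probability (borel R n) R) (pstar : R),
        0 <= p -> 0 < capacity K p -> equilibrium_measure K p mu ->
        p < pstar -> (energy K (riesz_kernel pstar) mu < +oo)%E ->
        capacity K r @[r --> p^'+] --> capacity K p /\
        {for p, continuous (capacity K)})].
Proof.
have [K0|/eqP K0] := eqVneq K set0.
  have cK : capacity K = cst 0.
    by apply/funext => r; rewrite K0 capacity_set0.
  by rewrite cK; split=> *; try split; exact: cvg_cst.
have [D D0 hD] := enorm_diam hK.
have left p : capacity K r @[r --> p^'-] --> capacity K p.
  have r0p : p - 1 < p by lra.
  exact: (capacity_left hK K0 D0 hD erefl r0p).
have cont p : capacity K r @[r --> p^'+] --> capacity K p -> {for p, continuous (capacity K)}.
  by move=> right; apply/left_right_continuousP.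
split=> //.
  move=> p pneg; apply: cont.
  have r0p : p - 1 < p by lra.
  have pps : p < p / 2 by lra.
  have ps0 : p / 2 < 0 by lra.
  apply: (capacity_right hK K0 D0 hD erefl r0p pps) => // c c0.
  move=> /(lt_capacity hK K0 D0 hD erefl (ltW r0p) c0)[mu muK Emu].
  exists mu; split => //; apply: (pot_energy_neg_lty D0 erefl _ _ ps0).
  exact: ltW (lt_trans r0p pps).
move=> p mu ps p0 capp [muK mumin] pps Eps.
suff right : capacity K r @[r --> p^'+] --> capacity K p by split=> //; exact: cont.
have r0p : p - 1 < p by lra.
have r0ps := lt_trans r0p pps.
have ps0 : 0 < ps by exact: le_lt_trans pps.
have ps_neq0 : ps != 0 by rewrite gt_eqF.
apply: (capacity_right hK K0 D0 hD erefl r0p pps) => [|c c0 ccap]; first by rewrite ltNge p0.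
exists mu; split => //; last first.
  move: Eps; rewrite (riesz_energyE hK D0 hD erefl (ltW r0ps) ps_neq0 muK).
  case: pot_energy => [v _||_]; [exact: ltry| |by []].
  by rewrite gt0_muley ?lte_fin// addye.
move: p0; rewrite le_eqVlt => /orP[/eqP p0|p0].
  rewrite -p0 in mumin r0p ccap *; rewrite eqxx in mumin.
  move: ccap; rewrite (capacity_zero hK D0 hD erefl (ltW r0p) c0).1 -mumin.
  rewrite (log_energyE hK D0 hD erefl (ltW r0p) muK) affine_lt_pos//.
  by rewrite divr1 opprK /potr eqxx.
have pn0 : p != 0 by rewrite gt_eqF.
rewrite (negbTE pn0) in mumin.
move: ccap; rewrite (capacity_pos hK D0 hD erefl (ltW r0p) p0 c0).1 -mumin.
rewrite (riesz_energyE hK D0 hD erefl (ltW r0p) pn0 muK) affine_lt_pos//.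
by rewrite powR_potr.
Qed.
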